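(* Let $2<p<\infty$. Then there is $g\in\Lambda\left(p,\frac1p\right)$ such that $\mathcal{H}_g:H^p\to H^1$ is not bounded. In particular, $\mathcal{H}_g$ is not bounded on $H^p$ (i.e. from $H^p$ to $H^p$).
   Context: $\mathbb{D}$ is the open unit disc in $\mathbb{C}$. For $f$ analytic on $\mathbb{D}$, $0<p<\infty$ and $0<r<1$, put $M_p(r,f)=\left(\frac1{2\pi}\int_0^{2\pi}|f(re^{i\theta})|^p\,d\theta\right)^{1/p}$. The Hardy space $H^p$ consists of the analytic $f$ on $\mathbb{D}$ with $\|f\|_{H^p}=\sup_{0<r<1}M_p(r,f)<\infty$. For $g$ analytic on $\mathbb{D}$, the generalized Hilbert operator is $$\mathcal{H}_g(f)(z)=\int_0^1 f(t)g'(tz)\,dt,\qquad z\in\mathbb{D},\ f\in H^1;$$ the integral converges absolutely for $f\in H^1$ (by the Fejér–Riesz inequality) and defines an analytic function on $\mathbb{D}$. $\mathcal{H}_g:H^p\to H^q$ is bounded if there is a constant $C$ with $\|\mathcal{H}_g(f)\|_{H^q}\le C\|f\|_{H^p}$ for all $f\in H^p$. Mean Lipschitz spaces: for $1\le p<\infty$, $0<\alpha\le1$, $\Lambda(p,\alpha)$ consists of the $g\in H^p$ whose non-tangential boundary values $g(e^{i\theta})$ satisfy $\omega_p(g,t)=O(t^\alpha)$ as $t\to0$, where $$\omega_p(g,t)=\sup_{0<h\le t}\left(\int_0^{2\pi}|g(e^{i(\theta+h)})-g(e^{i\theta})|^p\frac{d\theta}{2\pi}\right)^{1/p}.$$ Equivalently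 (Hardy–Littlewood), $g\in H^p$ and $M_p(r,g')=O((1-r)^{\alpha-1})$ as $r\to1^-$. *)

(* Defs.v *)
(* The complex numbers are [R[i]] for [R : realType].
   Functions on the disc (or on the circle) are total functions on [R[i]] whose
   values elsewhere are never used. *)
From mathcomp Require Import all_boot all_order all_algebra.
From mathcomp Require Import complex.
From mathcomp Require Import all_classical all_reals all_analysis.

Set Implicit Arguments.
Unset Strict Implicit.
Unset Printing Implicit Defensive.

Import Order.TTheory GRing.Theory Num.Theory.
Import numFieldTopology.Exports numFieldNormedType.Exports.

Local Open Scope classical_set_scope.
Local Open Scope ring_scope.
Local Open Scope complex_scope.

(* [R[i]] with the structure that triggers the normed topology of a
   [numClosedFieldType] over itself, so that [derivable] and [derive1] below are
   complex differentiability and the complex derivative. *)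
Definition Cplx (R : realType) : numClosedFieldType := R[i].

(* Modulus as an element of [R] (the generic norm of [R[i]] takes values in
   [R[i]]). *)
Definition cabs (R : realType) (z : Cplx R) : R := complex.Re `|z|.

Definition of_real (R : realType) (t : R) : Cplx R := t%:C.

Definition expi (R : realType) (theta : R) : Cplx R :=
  (cos theta) +i* (sin theta).

Definition disc (R : realType) : set (Cplx R) := [set z | cabs z < 1].

Definition analytic_on_disc (R : realType) (f : Cplx R -> Cplx R) : Prop :=
  forall z, disc z -> derivable f z 1.

Definition circle_mean (R : realType) (p : R) (u : R -> Cplx R) : \bar R :=
  (((2 * pi)^-1)%:E *
    \int[lebesgue_measure]_(theta in `[0%R, (2 * pi)%R])
      (cabs (u theta) `^ p)%:E) `^ (p^-1).

Definition integral_mean (R : realType) (p r : R) (f : Cplx R -> Cplx R) :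
    \bar R :=
  circle_mean p (fun theta => f (of_real r * expi theta)).

Definition hardy_norm (R : realType) (p : R) (f : Cplx R -> Cplx R) : \bar R :=
  ereal_sup [set integral_mean p r f | r in `]0%R, 1%R[].

Definition hardy (R : realType) (p : R) : set (Cplx R -> Cplx R) :=
  [set f | analytic_on_disc f /\ (hardy_norm p f < +oo)%E].

Definition cintegral (R : realType) (A : set R) (F : R -> Cplx R) : Cplx R :=
  (\int[lebesgue_measure]_(t in A) complex.Re (F t))%R +i*
  (\int[lebesgue_measure]_(t in A) complex.Im (F t))%R.

(* The endpoint [1], where [f] has no value, is left out.  For [f] in [hardy 1]
   the integrand is integrable by the Fejer-Riesz inequality. *)
Definition hilbert_op (R : realType) (g f : Cplx R -> Cplx R) (z : Cplx R) :
    Cplx R :=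
  cintegral `[0%R, 1%R[ (fun t : R => f (of_real t) * derive1 g (of_real t * z)).

Definition hilbert_bounded (R : realType) (g : Cplx R -> Cplx R) (p q : R) :
    Prop :=
  exists C : R, forall f, hardy p f ->
    (hardy_norm q (hilbert_op g f) <= C%:E * hardy_norm p f)%E.

Definition stolz (R : realType) (sigma : R) (zeta : Cplx R) : set (Cplx R) :=
  [set z | disc z /\ cabs (zeta - z) < sigma * (1 - cabs z)].

Definition nt_limit (R : realType) (g : Cplx R -> Cplx R) (zeta w : Cplx R) :
    Prop :=
  forall sigma : R, 1 < sigma ->
    g z @[z --> within (stolz sigma zeta) (nbhs zeta)] --> w.

(* For [g] in a Hardy space such a [b] exists (Fatou) and is unique up to a null
   set of the circle, so that [omega p b] depends on [g] only. *)
Definition boundary_values (R : realType) (g b : Cplx R -> Cplx R) : Prop :=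
  {ae lebesgue_measure, forall theta : R,
    nt_limit g (expi theta) (b (expi theta))}.

Definition omega (R : realType) (p : R) (b : Cplx R -> Cplx R) (t : R) :
    \bar R :=
  ereal_sup [set circle_mean p
                   (fun theta => b (expi (theta + h)) - b (expi theta))
            | h in `]0%R, t]].

Definition mean_lipschitz (R : realType) (p alpha : R) :
    set (Cplx R -> Cplx R) :=
  [set g | hardy p g /\
    exists2 b : Cplx R -> Cplx R, boundary_values g b &
    exists K : R, \forall t \near 0^'+,
      (omega p b t <= (K * t `^ alpha)%:E)%E].

(* Main.v *)
(** Let [gam = 2^(1/p)], [g(z) = sum_k gam^(-k) z^(2^k)] and
    [f_N(z) = sum_(j < N) (gam/2)^j / (1 - (1 - 2^(-j)) z)].
    The lacunary series [g] is Hoelder continuous of order [1/p] on the closed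
    disc, hence lies in [Lambda(p, 1/p)].  On the circle [|f_N|] is of the order
    of [min (|z - 1|^(-1/p)) gam^N], so that [||f_N||_p = O(N^(1/p))].  The
    moments of [f_N] make [H_g f_N] the lacunary sum
    [sum_(k < N) c_k z^(2^k - 1)] with [c_k >= 1/8], up to a bounded error.
    Pairing it with a Rudin-Shapiro polynomial of frequencies [2^k], which is
    bounded and has coefficients [N^(-1/2)] at these frequencies, shows that
    its [H^1] norm is at least [c sqrt N - C].  As [p > 2], no multiple of
    [N^(1/p)] dominates [sqrt N]. *)
Require Import Defs.
From mathcomp Require Import all_boot all_order all_algebra.
From mathcomp Require Import complex ring lra zify.
From mathcomp Require Import all_classical all_reals all_analysis measurable_realfun.

Set Implicit Arguments.
Unset Strict Implicit.
Unset Printing Implicit Defensive.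

Import Order.TTheory GRing.Theory Num.Theory.
Import numFieldTopology.Exports numFieldNormedType.Exports.

Local Open Scope classical_set_scope.
Local Open Scope ring_scope.
Local Open Scope complex_scope.

(** * Complex modulus and complex series *)

(** The function [f_N] imitates [(1 - z)^(-1/p)], which just fails to lie in [H^p]: at distance
    about [2^(-m)] from [1], on an arc of about that length, [|f_N|^p] is about [gam^(p m) = 2^m],
    so each of roughly [N] dyadic scales contributes a bounded amount. A sum of Cauchy kernels
    replaces the power because it can be bounded above term by term and is positive on [[0, 1)],
    where a single term bounds a moment from below. The moment of order [2^k - 1] is at least a
    constant times [(gam/2)^k], and the coefficient [(2/gam)^k] of [g'] cancels exactly this factor;
    hence [N] coefficients of order one and an [L^2] norm of order [sqrt N]. Lacunary series have
    comparable [L^1] and [L^2] norms; the Rudin-Shapiro pairing makes the required half of this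
    explicit. Means over the circle increase with the exponent, so one lower bound for every
    [q >= 1] serves both target spaces. *)

Section ComplexModulus.
Variable R : realType.
Implicit Types z w : Cplx R.

Lemma cabsE z : cabs z = Num.sqrt (complex.Re z ^+ 2 + complex.Im z ^+ 2).
Proof. by rewrite /cabs normc_def. Qed.

Lemma norm_cabs z : `|z| = (cabs z)%:C.
Proof. by rewrite cabsE -normc_def. Qed.

Lemma cabs_ge0 z : 0 <= cabs z.
Proof. by rewrite cabsE sqrtr_ge0. Qed.

Lemma cabs0 : cabs (0 : Cplx R) = 0.
Proof. by rewrite /cabs normr0. Qed.

Lemma cabs1 : cabs (1 : Cplx R) = 1.
Proof. by rewrite /cabs normr1. Qed.

Lemma cabsN z : cabs (- z) = cabs z.
Proof. by rewrite /cabs normrN. Qed.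

Lemma cabsM z w : cabs (z * w) = cabs z * cabs w.
Proof.
by apply: complexI; rewrite rmorphM /= -!norm_cabs normrM.
Qed.

Lemma cabsD z w : cabs (z + w) <= cabs z + cabs w.
Proof. by rewrite -lecR rmorphD /= -!norm_cabs ler_normD. Qed.

Lemma cabsB z w : cabs (z - w) <= cabs z + cabs w.
Proof. by rewrite -(cabsN w) cabsD. Qed.

Lemma cabsX z n : cabs (z ^+ n) = cabs z ^+ n.
Proof. by elim: n => [|n IH]; rewrite ?expr0 ?cabs1// !exprS cabsM IH. Qed.

Lemma cabsV z : cabs z^-1 = (cabs z)^-1.
Proof. by apply: complexI; rewrite fmorphV /= -!norm_cabs normfV. Qed.

Lemma cabs_real (x : R) : cabs (of_real x) = `|x|.
Proof. by rewrite cabsE /= expr0n addr0 sqrtr_sqr. Qed.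

Lemma cabs_eq0 z : (cabs z == 0) = (z == 0).
Proof. by rewrite -(inj_eq (@complexI R)) -norm_cabs normr_eq0. Qed.

Lemma cabs_sum n (F : nat -> Cplx R) :
  cabs (\sum_(i < n) F i) <= \sum_(i < n) cabs (F i).
Proof.
elim: n => [|n IH]; first by rewrite !big_ord0 cabs0.
by rewrite !big_ord_recr /= (le_trans (cabsD _ _))// lerD2r.
Qed.

Lemma Re_le_cabs z : `|complex.Re z| <= cabs z.
Proof. by rewrite cabsE -sqrtr_sqr; apply: (@ler_wsqrtr R); rewrite lerDl sqr_ge0. Qed.

Lemma Im_le_cabs z : `|complex.Im z| <= cabs z.
Proof. by rewrite cabsE -sqrtr_sqr; apply: (@ler_wsqrtr R); rewrite lerDr sqr_ge0. Qed.

Lemma cabs_le_ReIm z : cabs z <= `|complex.Re z| + `|complex.Im z|.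
Proof.
have <- : Num.sqrt ((`|complex.Re z| + `|complex.Im z|) ^+ 2) =
  `|complex.Re z| + `|complex.Im z| by rewrite sqrtr_sqr ger0_norm ?addr_ge0.
rewrite cabsE; apply: (@ler_wsqrtr R).
by rewrite sqrrD !real_normK ?num_real// lerD2r lerDl mulrn_wge0// mulr_ge0.
Qed.

Lemma of_realM (x y : R) : of_real (x * y) = of_real x * of_real y.
Proof. by rewrite /of_real rmorphM. Qed.

Lemma of_realX (x : R) n : of_real (x ^+ n) = of_real x ^+ n.
Proof. by rewrite /of_real rmorphXn. Qed.

Lemma of_realV (x : R) : of_real x^-1 = (of_real x)^-1.
Proof. by rewrite /of_real fmorphV. Qed.

Lemma of_realB (x y : R) : of_real (x - y) = of_real x - of_real y.
Proof. by rewrite /of_real rmorphB. Qed.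

Lemma of_real1 : of_real (1 : R) = 1.
Proof. by rewrite /of_real rmorph1. Qed.

Lemma of_real_sum n (F : nat -> R) :
  of_real (\sum_(i < n) F i) = \sum_(i < n) of_real (F i).
Proof. by rewrite /of_real rmorph_sum. Qed.

Lemma ReD z w : complex.Re (z + w) = complex.Re z + complex.Re w.
Proof. by case: z => a b; case: w => c d. Qed.

Lemma ImD z w : complex.Im (z + w) = complex.Im z + complex.Im w.
Proof. by case: z => a b; case: w => c d. Qed.

Lemma ReM z w : complex.Re (z * w) =
  complex.Re z * complex.Re w - complex.Im z * complex.Im w.
Proof. by case: z => a b; case: w => c d. Qed.

Lemma ImM z w : complex.Im (z * w) =
  complex.Re z * complex.Im w + complex.Im z * complex.Re w.
Proof. by case: z => a b; case: w => c d; rewrite /= . Qed.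

Lemma Re_sum n (F : nat -> Cplx R) :
  complex.Re (\sum_(i < n) F i) = \sum_(i < n) complex.Re (F i).
Proof.
by elim: n => [|n IH]; rewrite ?big_ord0// !big_ord_recr ReD IH.
Qed.

Lemma Im_sum n (F : nat -> Cplx R) :
  complex.Im (\sum_(i < n) F i) = \sum_(i < n) complex.Im (F i).
Proof.
by elim: n => [|n IH]; rewrite ?big_ord0// !big_ord_recr ImD IH.
Qed.

Lemma ReMr (x : R) z : complex.Re (of_real x * z) = x * complex.Re z.
Proof. by rewrite ReM /= mul0r subr0. Qed.

Lemma ImMr (x : R) z : complex.Im (of_real x * z) = x * complex.Im z.
Proof. by rewrite ImM /= mul0r addr0. Qed.

Lemma complex_eq z w : complex.Re z = complex.Re w ->
  complex.Im z = complex.Im w -> z = w.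
Proof. by case: z => a b; case: w => c d /= -> ->. Qed.

Lemma cabs_expi (t : R) : cabs (expi t) = 1.
Proof. by rewrite cabsE /= cos2Dsin2 sqrtr1. Qed.

Lemma expiD (s t : R) : expi (s + t) = expi s * expi t.
Proof.
apply: complex_eq; first by rewrite ReM /= cosD.
by rewrite ImM /= sinD addrC.
Qed.

Lemma expi0 : expi (0 : R) = 1.
Proof. by rewrite /expi cos0 sin0. Qed.

Lemma expiMn (t : R) n : expi (n%:R * t) = expi t ^+ n.
Proof.
elim: n => [|n IH]; first by rewrite mul0r expi0.
by rewrite -natr1 mulrDl mul1r expiD IH exprSr.
Qed.

End ComplexModulus.

Section ComplexSeries.
Variable R : realType.
Implicit Types (u v : nat -> Cplx R) (B : R).

(* Absolute convergence in a form that needs no limit. *)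
Definition abs_bounded u B := forall n, \sum_(k < n) cabs (u k) <= B.

(** Limits are taken in [R], part by part, which reduces every convergence question to real series;
    the price is the factor [2] in [cabs_csum]. *)
Definition csum u : Cplx R :=
  limn (fun n => \sum_(k < n) complex.Re (u k)) +i*
  limn (fun n => \sum_(k < n) complex.Im (u k)).

Lemma abs_bounded_cvg (a : nat -> R) B :
  (forall n, \sum_(k < n) `|a k| <= B) -> cvgn (fun n => \sum_(k < n) a k).
Proof.
move=> aB.
have : cvgn [normed series a].
  apply: nondecreasing_is_cvgn.
    apply/nondecreasing_seqP => n.
    by rewrite /normed_series_of /= /series /= big_nat_recr//= lerDl.
  by exists B => _ [n _ <-]; have := aB n; rewrite -(big_mkord xpredT (fun k => `|a k|)).
move/normed_cvg.
suff -> : (fun n => \sum_(k < n) a k) = series a by [].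
by apply/funext => n; rewrite /series /= big_mkord.
Qed.

Lemma csum_cvgRe u B : abs_bounded u B ->
  (fun n => \sum_(k < n) complex.Re (u k)) @ \oo --> complex.Re (csum u).
Proof.
move=> uB; apply: (@abs_bounded_cvg (fun k => complex.Re (u k)) B).
by move=> n; apply: le_trans (uB n); apply: ler_sum => k _; exact: Re_le_cabs.
Qed.

Lemma csum_cvgIm u B : abs_bounded u B ->
  (fun n => \sum_(k < n) complex.Im (u k)) @ \oo --> complex.Im (csum u).
Proof.
move=> uB; apply: (@abs_bounded_cvg (fun k => complex.Im (u k)) B).
by move=> n; apply: le_trans (uB n); apply: ler_sum => k _; exact: Im_le_cabs.
Qed.

Lemma csum_unique u z :
  (fun n => \sum_(k < n) complex.Re (u k)) @ \oo --> complex.Re z ->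
  (fun n => \sum_(k < n) complex.Im (u k)) @ \oo --> complex.Im z ->
  csum u = z.
Proof. by move=> uz vz; apply: complex_eq => /=; apply/cvg_lim. Qed.

Lemma abs_bounded_Re u B : abs_bounded u B -> `|complex.Re (csum u)| <= B.
Proof.
move=> uB; have h : `|\sum_(k < n) complex.Re (u k)| @[n --> \oo] --> `|complex.Re (csum u)|.
  by apply: cvg_norm; exact: csum_cvgRe uB.
rewrite -(cvg_lim _ h)//; apply: limr_le; first by apply/cvg_ex; eexists; exact: h.
near=> n; apply: le_trans (uB n); apply: le_trans (ler_norm_sum _ _ _) _.
by apply: ler_sum => k _; exact: Re_le_cabs.
Unshelve. all: by end_near. Qed.

Lemma abs_bounded_Im u B : abs_bounded u B -> `|complex.Im (csum u)| <= B.
Proof.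
move=> uB; have h : `|\sum_(k < n) complex.Im (u k)| @[n --> \oo] --> `|complex.Im (csum u)|.
  by apply: cvg_norm; exact: csum_cvgIm uB.
rewrite -(cvg_lim _ h)//; apply: limr_le; first by apply/cvg_ex; eexists; exact: h.
near=> n; apply: le_trans (uB n); apply: le_trans (ler_norm_sum _ _ _) _.
by apply: ler_sum => k _; exact: Im_le_cabs.
Unshelve. all: by end_near. Qed.

Lemma cabs_csum u B : abs_bounded u B -> cabs (csum u) <= 2 * B.
Proof.
move=> uB; apply: le_trans (cabs_le_ReIm _) _.
by rewrite mulr_natl mulr2n lerD ?abs_bounded_Re ?abs_bounded_Im.
Qed.

Lemma csumD u v B B' : abs_bounded u B -> abs_bounded v B' ->
  csum (fun k => u k + v k) = csum u + csum v.
Proof.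
move=> uB vB; apply: csum_unique.
- under eq_fun do under eq_bigr do rewrite ReD.
  under eq_fun do rewrite big_split.
  rewrite ReD; exact: cvgD (csum_cvgRe uB) (csum_cvgRe vB).
- under eq_fun do under eq_bigr do rewrite ImD.
  under eq_fun do rewrite big_split.
  rewrite ImD; exact: cvgD (csum_cvgIm uB) (csum_cvgIm vB).
Qed.

Lemma csumZ c u B : abs_bounded u B -> csum (fun k => c * u k) = c * csum u.
Proof.
move=> uB; apply: csum_unique.
- under eq_fun do under eq_bigr do rewrite ReM.
  under eq_fun do rewrite sumrB -!mulr_sumr.
  rewrite ReM.
  apply: cvgB; (apply: cvgM; first exact: cvg_cst).
    exact: csum_cvgRe uB.
  exact: csum_cvgIm uB.
- under eq_fun do under eq_bigr do rewrite ImM.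
  under eq_fun do rewrite big_split -!mulr_sumr.
  rewrite ImM.
  apply: cvgD; (apply: cvgM; first exact: cvg_cst).
    exact: csum_cvgIm uB.
  exact: csum_cvgRe uB.
Qed.

Lemma csum_split u B N : abs_bounded u B ->
  csum u = \sum_(k < N) u k + csum (fun k => u (N + k)%N).
Proof.
move=> uB; apply/eqP; rewrite addrC -subr_eq; apply/eqP/esym; apply: csum_unique.
- have := csum_cvgRe uB; rewrite -(cvg_shiftn N) => h.
  have -> : (fun n => \sum_(k < n) complex.Re (u (N + k)%N)) =
      (fun n => (\sum_(k < n + N) complex.Re (u k)) - \sum_(k < N) complex.Re (u k)).
    apply/funext => n; rewrite addnC big_split_ord /= [RHS]addrC addKr.
    by [].
  have -> : complex.Re (csum u - \sum_(i < N) u i) =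
     complex.Re (csum u) - \sum_(k < N) complex.Re (u k).
    rewrite -Re_sum; case: (csum u) => a b; by case: (\sum_(i < N) u i) => c d.
  by apply: cvgB => //; exact: cvg_cst.
- have := csum_cvgIm uB; rewrite -(cvg_shiftn N) => h.
  have -> : (fun n => \sum_(k < n) complex.Im (u (N + k)%N)) =
      (fun n => (\sum_(k < n + N) complex.Im (u k)) - \sum_(k < N) complex.Im (u k)).
    by apply/funext => n; rewrite addnC big_split_ord /= [RHS]addrC addKr.
  have -> : complex.Im (csum u - \sum_(i < N) u i) =
     complex.Im (csum u) - \sum_(k < N) complex.Im (u k).
    rewrite -Im_sum; case: (csum u) => a b; by case: (\sum_(i < N) u i) => c d.
  by apply: cvgB => //; exact: cvg_cst.
Qed.

Lemma abs_boundedS u B N : abs_bounded u B -> abs_bounded (fun k => u (N + k)%N) B.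
Proof.
move=> uB n; apply: le_trans (uB (N + n)%N); rewrite big_split_ord /= lerDr.
by apply: sumr_ge0 => k _; exact: cabs_ge0.
Qed.

Lemma abs_boundedD u v B B' : abs_bounded u B -> abs_bounded v B' ->
  abs_bounded (fun k => u k + v k) (B + B').
Proof.
move=> uB vB n; apply: le_trans (lerD (uB n) (vB n)); rewrite -big_split.
by apply: ler_sum => k _; exact: cabsD.
Qed.

Lemma abs_boundedZ c u B : abs_bounded u B ->
  abs_bounded (fun k => c * u k) (cabs c * B).
Proof.
move=> uB n; under eq_bigr do rewrite cabsM.
by rewrite -mulr_sumr ler_wpM2l// cabs_ge0.
Qed.

End ComplexSeries.

(** * Circle means *)

Section RealTools.
Variable R : realType.

Lemma geometric_sum_le (tau : R) n : 0 <= tau < 1 ->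
  \sum_(k < n) tau ^+ k <= (1 - tau)^-1.
Proof.
move=> /andP[t0 t1]; have d0 : 0 < 1 - tau by lra.
rewrite -(ler_pM2l d0) divff ?gt_eqF// -opprB mulNr -subrX1 opprB.
by rewrite gerBl exprn_ge0.
Qed.

(** With truncated subtraction the exponent is [|k - m|]; each side of [m] is a geometric series.
    Every sum dominated by one dyadic scale [m] is bounded in this way. *)
Lemma two_sided_geometric_sum_le (tau : R) m n : 0 <= tau < 1 ->
  \sum_(k < n) tau ^+ ((k - m) + (m - k)) <= 2 / (1 - tau).
Proof.
move=> t01; have /andP[t0 t1] := t01.
have mono : \sum_(k < n) tau ^+ ((k - m) + (m - k)) <=
    \sum_(k < m + n) tau ^+ ((k - m) + (m - k)).
  rewrite addnC big_split_ord /= lerDl.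
  by apply: sumr_ge0 => k _; rewrite exprn_ge0.
apply: le_trans mono _; rewrite big_split_ord /= mulr_natl mulr2n; apply: lerD.
  have -> : \sum_(i < m) tau ^+ (i - m + (m - i)) = \sum_(i < m) tau ^+ i.+1.
    rewrite (reindex_inj rev_ord_inj) /=; apply: eq_bigr => i _.
    congr (_ ^+ _); have := ltn_ord i; move: (nat_of_ord i) => j; lia.
  apply: le_trans (geometric_sum_le m t01); apply: ler_sum => k _.
  by rewrite exprS ler_piMl ?exprn_ge0// ltW.
apply: le_trans (geometric_sum_le n t01); apply: ler_sum => k _.
suff -> : (m + k - m + (m - (m + k)) = k)%N by [].
lia.
Qed.

(* Unlike [ge0_le_integral], this asks for no measurability: the integral of a
   nonnegative function is a supremum over simple functions below it. *)
Lemma ge0_integral_mono d (T : measurableType d) (mu : {measure set T -> \bar R})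
    (D : set T) (f1 f2 : T -> \bar R) :
  (forall x, D x -> 0 <= f1 x)%E -> (forall x, D x -> f1 x <= f2 x)%E ->
  (\int[mu]_(x in D) f1 x <= \int[mu]_(x in D) f2 x)%E.
Proof.
move=> f10 f12.
have f20 x : D x -> (0 <= f2 x)%E by move=> Dx; apply: le_trans (f12 x Dx); exact: f10.
rewrite !ge0_integralE//; apply: le_ereal_sup => _ [h /= hf1 <-]; exists h => //= x.
apply: le_trans (hf1 x) _; rewrite /patch; case: ifPn => // xD.
by apply: f12; rewrite inE in xD.
Qed.

(** An affine minorant of the power that vanishes at [l]: to the left of [l] it is negative, to the
    right the slope [l^(q-1)] is at most [x^(q-1)]. It stands in for Jensen's inequality. *)
Lemma powR_tangent_le (q l x : R) : 1 <= q -> 0 <= x -> 0 < l ->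
  l `^ (q - 1) * x - l `^ q <= x `^ q.
Proof.
move=> q1 x0 l0; have q0 : 0 < q by apply: lt_le_trans q1.
have [lx|xl] := leP l x.
  apply: le_trans (_ : l `^ (q - 1) * x <= _); first by rewrite gerBl powR_ge0.
  rewrite -(mulr_powRB1 x0 q0) mulrC ler_wpM2l//.
  by rewrite ge0_ler_powR ?subr_ge0// nnegrE// ltW.
apply: le_trans (powR_ge0 _ _); rewrite subr_le0 -(mulr_powRB1 (ltW l0) q0).
by rewrite mulrC ler_wpM2r ?powR_ge0// ltW.
Qed.

(** The gap [s = 1/2 - 1/p] is positive because [p > 2]; it suffices that [x^s] exceeds [|a| + |b|],
    since [x^(1/p) >= 1] absorbs [b]. *)
Lemma unbounded_sqrt_vs_root (p a b : R) : 2 < p ->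
  exists N : nat, a * N.+1%:R `^ p^-1 + b < Num.sqrt N.+1%:R.
Proof.
move=> p2; set s := 2^-1 - p^-1.
have s0 : 0 < s by rewrite subr_gt0 ltf_pV2// posrE; lra.
set c := `|a| + `|b|.
have c0 : 0 <= c by rewrite addr_ge0.
have := archi_boundP (powR_ge0 c s^-1); set N := Num.bound _ => cN.
exists N; set x : R := N.+1%:R.
have x1 : 1 <= x by rewrite ler1n.
have cx : c < x `^ s.
  have -> : c = (c `^ s^-1) `^ s by rewrite -powRrM mulVf ?gt_eqF// powRr1.
  apply: gt0_ltr_powR; rewrite ?nnegrE ?powR_ge0//.
  by apply: lt_trans cN _; rewrite ltr_nat.
have xp1 : 1 <= x `^ p^-1.
  by rewrite -(powRr0 x) ler_powR// invr_ge0; lra.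
have -> : Num.sqrt x = x `^ p^-1 * x `^ s.
  rewrite -powRD; first by rewrite addrC subrK powR12_sqrt// (le_trans _ x1).
  by apply/implyP => _; rewrite gt_eqF// (lt_le_trans _ x1).
apply: le_lt_trans (_ : x `^ p^-1 * c < _); last first.
  by rewrite ltr_pM2l// (lt_le_trans _ xp1).
rewrite mulrDr; apply: lerD.
  by rewrite mulrC ler_wpM2l ?ler_norm// (le_trans _ xp1).
apply: le_trans (ler_norm b) _; rewrite ler_peMl//.
Qed.

Lemma poweR_le (x y : \bar R) r : 0 <= r -> (0 <= x)%E -> (x <= y)%E ->
  (x `^ r <= y `^ r)%E.
Proof.
move=> r0 x0 xy; apply: gt0_ler_poweR => //; rewrite in_itv /= leey andbT//.
exact: le_trans xy.
Qed.

End RealTools.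

Section CircleMeans.
Variable R : realType.
Implicit Types (u : R -> Cplx R).
Notation mu := (@lebesgue_measure R).

Lemma measure_0_2pi : mu `[0%R, (2 * pi)%R] = (2 * pi)%:E.
Proof.
by rewrite lebesgue_measure_itv /= lte_fin mulr_gt0 ?pi_gt0// sube0.
Qed.

Lemma circle_mean_le p u (h : R -> \bar R) V : 0 < p -> 0 <= V ->
  (forall t, 0 <= t <= 2 * pi -> ((cabs (u t) `^ p)%:E <= h t)%E) ->
  (\int[mu]_(t in `[0%R, (2 * pi)%R]) h t <= (2 * pi * V)%:E)%E ->
  (circle_mean p u <= (V `^ p^-1)%:E)%E.
Proof.
move=> p0 V0 uh hV; rewrite /circle_mean -poweR_EFin.
have pi20 : 0 < 2 * pi :> R by rewrite mulr_gt0 ?pi_gt0.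
have m0 : (0 <= \int[mu]_(t in `[0%R, (2 * pi)%R]) (cabs (u t) `^ p)%:E)%E.
  by apply: integral_ge0 => t _; rewrite lee_fin powR_ge0.
apply: poweR_le; first by rewrite invr_ge0 ltW.
  by rewrite mule_ge0// lee_fin invr_ge0 (ltW pi20).
apply: le_trans (_ : ((2 * pi)^-1%:E * (2 * pi * V)%:E <= _)%E); last first.
  by rewrite -EFinM mulKf ?gt_eqF.
rewrite lee_pmul2l ?lte_fin ?invr_gt0//.
apply: le_trans hV; apply: ge0_integral_mono => t; rewrite /= in_itv /=.
  by rewrite lee_fin powR_ge0.
exact: uh.
Qed.

Lemma circle_mean_le_sup p u B : 0 < p -> 0 <= B ->
  (forall t, cabs (u t) <= B) -> (circle_mean p u <= B%:E)%E.
Proof.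
move=> p0 B0 uB; have -> : B = (B `^ p) `^ p^-1.
  by rewrite -powRrM divff ?gt_eqF// powRr1.
apply: (@circle_mean_le _ _ (fun=> (B `^ p)%:E)) => //; rewrite ?powR_ge0//.
  move=> t _; rewrite lee_fin ge0_ler_powR ?nnegrE ?cabs_ge0//; exact: ltW.
by rewrite integral_cst//= measure_0_2pi -EFinM mulrC.
Qed.

(** Integrating [powR_tangent_le] turns a mean of [L] of at least [2 l] into a mean of the [q]-th
    power of at least [l^(q-1) (2 l - l) = l^q]; the factor [2] pays for the constant term of the
    minorant. *)
Lemma circle_mean_ge q u (L : R -> R) (l : R) : 1 <= q -> 0 < l ->
  (forall t, L t <= cabs (u t)) ->
  mu.-integrable `[0%R, (2 * pi)%R] (EFin \o L) ->
  2 * pi * (2 * l) <= \int[mu]_(t in `[0%R, (2 * pi)%R]) L t ->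
  (l%:E <= circle_mean q u)%E.
Proof.
move=> q1 l0 Lu iL hL; have q0 : 0 < q by apply: lt_le_trans q1.
have pi20 : 0 < 2 * pi :> R by rewrite mulr_gt0 ?pi_gt0.
have -> : l = (l `^ q) `^ q^-1 by rewrite -powRrM divff ?gt_eqF// powRr1// ltW.
rewrite /circle_mean -poweR_EFin.
have m0 : (0 <= \int[mu]_(t in `[0%R, (2 * pi)%R]) (cabs (u t) `^ q)%:E)%E.
  by apply: integral_ge0 => t _; rewrite lee_fin powR_ge0.
apply: poweR_le; first by rewrite invr_ge0 ltW.
  by rewrite lee_fin powR_ge0.
rewrite -(@lee_pmul2l _ (2 * pi)%:E)// muleA -!EFinM divff ?gt_eqF// mul1e.
pose X t := l `^ (q - 1) * L t - l `^ q.
have iZ : mu.-integrable `[0%R, (2 * pi)%R] (EFin \o (fun t => l `^ (q - 1) * L t)).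
  have -> : EFin \o (fun t => l `^ (q - 1) * L t) =
      (fun t => (l `^ (q - 1))%:E * (EFin \o L) t)%E by apply/funext => t.
  exact: integrableZl.
have ic : mu.-integrable `[0%R, (2 * pi)%R] (EFin \o (fun=> l `^ q)).
  by apply: continuous_compact_integrable; [exact: segment_compact|exact: cst_continuous].
have iX : mu.-integrable `[0%R, (2 * pi)%R] (EFin \o X).
  by have := integrableB _ iZ ic; apply; exact: measurable_itv.
have IX : 2 * pi * l `^ q <= \int[mu]_(t in `[0%R, (2 * pi)%R]) X t.
  rewrite RintegralB// RintegralZl// Rintegral_cst//= measure_0_2pi /=.
  apply: le_trans (_ : l `^ (q - 1) * (2 * pi * (2 * l)) - l `^ q * (2 * pi) <= _).
    rewrite -[in leRHS](mulr_powRB1 (ltW l0) q0) -(mulr_powRB1 (ltW l0) q0).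
    by rewrite le_eqVlt; apply/orP; left; apply/eqP; ring.
  by rewrite lerB// ler_wpM2l ?powR_ge0.
apply: le_trans (_ : ((\int[mu]_(t in `[0%R, (2 * pi)%R]) X t)%:E <= _)%E).
  by rewrite lee_fin.
rewrite /Rintegral fineK; last exact: integrable_fin_num.
(* [X] may take negative values; its integral is first raised to that of its positive part, which
   lies pointwise below the [q]-th power of [cabs (u t)]. *)
rewrite integralE; apply: le_trans (_ : (\int[mu]_(t in `[0%R, (2 * pi)%R]) (EFin \o X)^\+ t <= _)%E).
  by rewrite -[leRHS]sube0 leeB// integral_ge0.
apply: ge0_integral_mono => t _; rewrite ?funepos_ge0//.
rewrite funeposE /= ge_max -[0%E]/(0%:E) !lee_fin powR_ge0 andbT.
apply: le_trans (powR_tangent_le q1 (cabs_ge0 _) l0).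
by rewrite lerB// ler_wpM2l ?powR_ge0.
Qed.

End CircleMeans.

(** * The complex derivative *)

Section ComplexDerivative.
Variable R : realType.
Implicit Types (f : Cplx R -> Cplx R) (z w h d : Cplx R).

Lemma gt0_of_real (e : Cplx R) : 0 < e -> e = of_real (complex.Re e) /\ 0 < complex.Re e.
Proof.
move=> e0; have := e0; rewrite ltcE /= => /andP[/eqP Ie Re0]; split => //.
by apply: complex_eq => /=.
Qed.

(** An explicit bound [B |h|^2] on the first-order remainder survives summation, so that series can
    be differentiated term by term without uniform convergence of derivatives. *)
Lemma cvg_of_quadratic f z d (B eta : R) : 0 < eta ->
  (forall h, cabs h < eta ->
     cabs (f (z + h) - f z - h * d) <= B * cabs h ^+ 2) ->
  (fun h => h^-1 *: (f (h *: 1 + z) - f z)) @ 0^' --> d.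
Proof.
move=> eta0 fB; apply/cvgrPdist_lt => e /gt0_of_real[-> e0].
set e' := complex.Re e in e0 *.
have B0 : 0 < `|B| + 1 by rewrite ltr_wpDl.
pose r := Num.min eta (e' / (`|B| + 1)).
have r0 : 0 < r by rewrite lt_min eta0 divr_gt0.
near=> h.
have h0 : h != 0 by near: h; exact: nbhs_dnbhs_neq.
have hr : cabs h < r.
  have : `|h| < of_real r.
    near: h; apply: dnbhs0_lt; by rewrite ltcR.
  by rewrite norm_cabs ltcR.
have ch0 : 0 < cabs h by rewrite lt_neqAle cabs_ge0 eq_sym cabs_eq0 h0.
rewrite norm_cabs ltcR; apply: le_lt_trans (_ : B * cabs h < _).
  have -> : d - h^-1 *: (f (h *: 1 + z) - f z) = - (h^-1 * (f (z + h) - f z - h * d)).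
    have -> : h *: 1 + z = z + h by rewrite addrC; congr (_ + _); exact: mulr1.
    by rewrite mulrBr mulKf// opprB.
  rewrite cabsN cabsM cabsV ler_pdivrMl//.
  apply: le_trans (fB _ _) _; first by apply: lt_le_trans hr _; rewrite ge_min lexx.
  by rewrite expr2 mulrCA.
apply: le_lt_trans (_ : (`|B| + 1) * cabs h < _).
  by rewrite ler_pM2r// (le_trans (ler_norm _))// lerDl.
by rewrite mulrC -ltr_pdivlMr// (lt_le_trans hr)// ge_min lexx orbT.
Unshelve. all: by end_near. Qed.

Lemma derivable_of_quadratic f z d (B eta : R) : 0 < eta ->
  (forall h, cabs h < eta ->
     cabs (f (z + h) - f z - h * d) <= B * cabs h ^+ 2) ->
  derivable f z 1 /\ derive1 f z = d.
Proof.
move=> eta0 /(cvg_of_quadratic eta0) fd; split; first by apply/cvg_ex; exists d.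
rewrite derive1E; exact: cvg_lim fd.
Qed.

Lemma cabs_subX z w n : cabs z <= 1 -> cabs w <= 1 ->
  cabs (z ^+ n - w ^+ n) <= n%:R * cabs (z - w).
Proof.
move=> z1 w1; elim: n => [|n IH]; first by rewrite !expr0 subrr cabs0 mul0r.
have -> : z ^+ n.+1 - w ^+ n.+1 = z * (z ^+ n - w ^+ n) + (z - w) * w ^+ n.
  by rewrite !exprS; ring.
apply: le_trans (cabsD _ _) _; rewrite -natr1 [leRHS]mulrDl mul1r; apply: lerD.
  by rewrite cabsM; apply: le_trans IH; rewrite ler_piMl// cabs_ge0.
by rewrite cabsM ler_piMr ?cabs_ge0// cabsX exprn_ile1// cabs_ge0.
Qed.

(** The factor [rho ^+ 2] on the left avoids the truncated exponent [n - 2] on the right. Each step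
    of the induction adds [n] to the constant, and [n^2 + n <= (n + 1)^2]. *)
Lemma cabs_subX_quadratic z w (rho : R) n : cabs z <= rho -> cabs w <= rho ->
  rho ^+ 2 * cabs (w ^+ n - z ^+ n - (w - z) * (n%:R * z ^+ n.-1)) <=
  n%:R ^+ 2 * rho ^+ n * cabs (w - z) ^+ 2.
Proof.
move=> zr wr; have r0 : 0 <= rho by apply: le_trans zr; exact: cabs_ge0.
elim: n => [|n IH].
  by rewrite !expr0 subrr mul0r mulr0 subr0 cabs0 !mulr0 expr0n mulr1 mul0r.
set D := cabs (w - z) in IH *.
have D0 : 0 <= D by exact: cabs_ge0.
have -> : w ^+ n.+1 - z ^+ n.+1 - (w - z) * (n.+1%:R * z ^+ n.+1.-1) =
    w * (w ^+ n - z ^+ n - (w - z) * (n%:R * z ^+ n.-1)) +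
    n%:R * z ^+ n.-1 * (w - z) ^+ 2.
  case: n {IH} => [|n] /=; first by rewrite !expr0 !expr1; ring.
  by rewrite -(natr1 n.+1) (exprS w n.+1) (exprS z n.+1) (exprS z n); ring.
have step : rho ^+ 2 * (n%:R * cabs z ^+ n.-1) <= n%:R * rho ^+ n.+1.
  case: n {IH} => [|n] /=; first by rewrite !mul0r mulr0.
  rewrite mulrCA ler_wpM2l// (exprS _ n.+1) (exprS _ n) expr2 -mulrA.
  by rewrite !ler_wpM2l// lerXn2r// nnegrE ?cabs_ge0.
apply: le_trans (_ : rho * (n%:R ^+ 2 * rho ^+ n * D ^+ 2) +
    n%:R * rho ^+ n.+1 * D ^+ 2 <= _); last first.
  rewrite -subr_ge0.
  have -> : n.+1%:R ^+ 2 * rho ^+ n.+1 * D ^+ 2 -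
     (rho * (n%:R ^+ 2 * rho ^+ n * D ^+ 2) + n%:R * rho ^+ n.+1 * D ^+ 2) =
     n.+1%:R * rho ^+ n.+1 * D ^+ 2.
    by rewrite -natr1 (exprS rho n); ring.
  by rewrite !mulr_ge0 ?exprn_ge0.
apply: le_trans (ler_wpM2l (exprn_ge0 2 r0) (cabsD _ _)) _.
rewrite mulrDr; apply: lerD.
  rewrite cabsM mulrCA ler_pM ?cabs_ge0// mulr_ge0 ?exprn_ge0 ?cabs_ge0//.
rewrite cabsM [cabs (_ ^+ 2)]cabsX cabsM [cabs (z ^+ _)]cabsX -/D mulrA ler_wpM2r ?exprn_ge0//.
suff -> : cabs (n%:R : Cplx R) = n%:R by [].
have -> : (n%:R : Cplx R) = of_real n%:R by rewrite /of_real rmorph_nat.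
by rewrite cabs_real normr_nat.
Qed.

Lemma mulr_exprn_le (s : R) n : 0 <= s < 1 -> n%:R * s ^+ n <= (1 - s)^-1.
Proof.
move=> s01; have /andP[s0 s1] := s01; apply: le_trans (geometric_sum_le n s01).
have -> : n%:R * s ^+ n = \sum_(i < n) s ^+ n.
  by rewrite sumr_const card_ord mulr_natl.
by apply: ler_sum => i _; rewrite ler_wiXn2l ?(ltW s1) ?(ltnW (ltn_ord i)).
Qed.

(* Fourth power of the previous bound, at the fourth root of [rho]. *)
Lemma expr4_exprn_le (rho : R) : 0 <= rho < 1 -> exists2 B, 0 <= B &
  forall n, n%:R ^+ 4 * rho ^+ n <= B.
Proof.
move=> /andP[r0 r1]; set s := Num.sqrt (Num.sqrt rho).
have s4 : s ^+ 4 = rho by rewrite (exprM s 2 2) !sqr_sqrtr ?sqrtr_ge0.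
have s0 : 0 <= s by exact: sqrtr_ge0.
have s1 : s < 1 by rewrite -(@ltr_pXn2r _ 4)// ?nnegrE// expr1n s4.
exists ((1 - s)^-1 ^+ 4); first by rewrite exprn_ge0// invr_ge0 subr_ge0 ltW.
move=> n; rewrite -s4 -exprM mulnC exprM -exprMn lerXn2r ?nnegrE ?mulr_ge0 ?exprn_ge0//.
  by rewrite invr_ge0 subr_ge0 ltW.
by apply: mulr_exprn_le; rewrite s0.
Qed.

End ComplexDerivative.

(** * The lacunary series *)

Section Dyadic.
Variable R : realType.

Lemma dyadic_scale (d : R) : 0 < d <= 1 ->
  exists m, 2 ^+ m * d <= 1 < 2 ^+ m.+1 * d.
Proof.
move=> /andP[d0 d1].
have ex : exists n, 1 < 2 ^+ n * d.
  have := archi_boundP (ltW (divr_gt0 ltr01 d0)); set n := Num.bound _ => dn.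
  exists n; rewrite -ltr_pdivrMr// (lt_le_trans dn)//.
  by rewrite -natrX ler_nat ltnW// ltn_expl.
case: (ex_minnP ex) => -[|m]; first by rewrite expr0 mul1r ltNge d1.
move=> dm min; exists m; rewrite dm andbT leNgt; apply/negP => /min.
by rewrite ltnn.
Qed.

End Dyadic.

Section Lacunary.
Variables (R : realType) (gam : R).
Hypotheses (gam_gt1 : 1 < gam) (gam_lt2 : gam < 2).
Implicit Types z w h : Cplx R.

Definition lac z : Cplx R :=
  csum (fun k => of_real (gam^-1 ^+ k) * z ^+ (2 ^ k)).

Definition lac_deriv z : Cplx R :=
  csum (fun k => of_real ((2 / gam) ^+ k) * z ^+ (2 ^ k).-1).

(** One ratio for both sides of a dyadic scale: in the lacunary series the terms decay like
    [gam / 2] below the scale and like [1 / gam] above it, in the test functions the other way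
    round. *)
Definition tau := Num.max (gam / 2) gam^-1.

Let gam_gt0 : 0 < gam. Proof. exact: lt_trans ltr01 gam_gt1. Qed.

Lemma gamV_01 : 0 <= gam^-1 < 1.
Proof. by rewrite invr_ge0 ltW//= invf_lt1. Qed.

Lemma tau_01 : 0 <= tau < 1.
Proof.
have /andP[g0 g1] := gamV_01.
by rewrite /tau le_max g0 orbT gt_max g1 andbT ltr_pdivrMr// mul1r.
Qed.

Lemma tau_gam2 n : (gam / 2) ^+ n <= tau ^+ n.
Proof. by rewrite lerXn2r ?nnegrE ?le_max ?lexx ?divr_ge0 ?(ltW gam_gt0). Qed.

Lemma tau_gamV n : gam^-1 ^+ n <= tau ^+ n.
Proof.
by rewrite lerXn2r ?nnegrE ?le_max ?lexx ?invr_ge0 ?(ltW gam_gt0) ?orbT.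
Qed.

(** The minimum is the size of the variation of [z^(2^k)] over a distance [d]. Up to [k = m] the
    Lipschitz bound [2^k d] is used, beyond it the trivial bound [1]. *)
Lemma gam_pow_min_le (d : R) m k : 0 <= d -> 2 ^+ m * d <= 1 ->
  gam^-1 ^+ k * Num.min 1 (2 ^+ k * d) <= gam^-1 ^+ m * tau ^+ ((k - m) + (m - k)).
Proof.
move=> d0 dm; have [km|mk] := leqP k m.
  rewrite (eqP km) add0n -(subnKC km) addKn; set j := (m - k)%N.
  apply: le_trans (_ : gam^-1 ^+ (k + j) * (gam / 2) ^+ j <= _); last first.
    by rewrite ler_wpM2l ?tau_gam2// exprn_ge0// invr_ge0 ltW.
  apply: le_trans (_ : gam^-1 ^+ k * (2 ^+ k * d) <= _).
    by rewrite ler_wpM2l ?ge_min ?lexx ?orbT// exprn_ge0// invr_ge0 ltW.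
  rewrite exprD -mulrA ler_wpM2l ?exprn_ge0 ?invr_ge0 ?(ltW gam_gt0)//.
  rewrite -exprMn mulrA mulVf ?gt_eqF// mul1r exprVn.
  by rewrite -[leRHS]mulr1 ler_pdivlMl ?exprn_gt0// mulrA -exprD /j subnK.
rewrite (eqP (ltnW mk)) addn0 -{1}(subnKC (ltnW mk)) exprD -mulrA.
rewrite ler_wpM2l ?exprn_ge0 ?invr_ge0 ?(ltW gam_gt0)//.
apply: le_trans (tau_gamV _); rewrite ler_piMr ?ge_min ?lexx//.
by rewrite exprn_ge0// invr_ge0 ltW.
Qed.

Lemma lac_abs z : cabs z <= 1 ->
  abs_bounded (fun k => of_real (gam^-1 ^+ k) * z ^+ (2 ^ k)) (1 - gam^-1)^-1.
Proof.
move=> z1 n; apply: le_trans (geometric_sum_le n gamV_01); apply: ler_sum => k _.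
have g0 : 0 <= gam^-1 ^+ k by rewrite exprn_ge0// invr_ge0 ltW.
by rewrite cabsM cabs_real cabsX ger0_norm// ler_piMr// exprn_ile1// cabs_ge0.
Qed.

Lemma cabs_lac z : cabs z <= 1 -> cabs (lac z) <= 2 * (1 - gam^-1)^-1.
Proof. by move=> z1; apply: cabs_csum; exact: lac_abs. Qed.

Lemma lac_sub z w : cabs z <= 1 -> cabs w <= 1 -> lac z - lac w =
  csum (fun k => of_real (gam^-1 ^+ k) * (z ^+ (2 ^ k) - w ^+ (2 ^ k))).
Proof.
move=> z1 w1; rewrite -[- lac w]mulN1r -(csumZ (-1) (lac_abs w1)).
rewrite -(csumD (lac_abs z1) (abs_boundedZ (-1) (lac_abs w1))); congr csum.
by apply/funext => k; rewrite mulN1r mulrBr.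
Qed.

(** From the outside in: the factor of [cabs_csum], the factor in
    [|z^n - w^n| <= 2 min(1, n |z - w|)], and the two-sided geometric sum. *)
Definition hoelder_const : R := 2 * (2 * (2 / (1 - tau))).

Lemma hoelder_const_ge0 : 0 <= hoelder_const.
Proof.
have /andP[_ t1] := tau_01.
by rewrite !mulr_ge0// invr_ge0 subr_ge0 ltW.
Qed.

Lemma lac_hoelder z w m : cabs z <= 1 -> cabs w <= 1 ->
  2 ^+ m * cabs (z - w) <= 1 ->
  cabs (lac z - lac w) <= hoelder_const * gam^-1 ^+ m.
Proof.
move=> z1 w1 dm; rewrite lac_sub// /hoelder_const -!mulrA.
apply: cabs_csum => n.
apply: le_trans (_ : \sum_(k < n) 2 * (gam^-1 ^+ m * tau ^+ ((k - m) + (m - k))) <= _).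
  apply: ler_sum => k _; rewrite cabsM cabs_real ger0_norm; last first.
    by rewrite exprn_ge0// invr_ge0 ltW.
  apply: le_trans (ler_wpM2l _ (gam_pow_min_le k (cabs_ge0 (z - w)) dm)) => //.
  rewrite mulrCA ler_wpM2l ?exprn_ge0 ?invr_ge0 ?(ltW gam_gt0)//.
  have [dk|dk] := leP 1 (2 ^+ k * cabs (z - w)).
    apply: le_trans (cabsB _ _) _; rewrite mulr1 -[leRHS]/(1 + 1) lerD//;
    by rewrite cabsX exprn_ile1 ?cabs_ge0.
  apply: le_trans (cabs_subX _ z1 w1) _; rewrite natrX ler_peMl ?mulr_ge0 ?exprn_ge0 ?cabs_ge0//.
  by rewrite ler1n.
rewrite -!mulr_sumr ler_wpM2l// [leRHS]mulrA [leRHS]mulrC ler_wpM2l//.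
  by rewrite exprn_ge0// invr_ge0 ltW.
exact: two_sided_geometric_sum_le tau_01.
Qed.

Lemma half_geometric_sum_le n : \sum_(k < n) 2^-1 ^+ k <= 2 :> R.
Proof.
have h : 0 <= (2^-1 : R) < 1 by rewrite invr_ge0 ler0n invf_lt1// ltr1n.
apply: le_trans (geometric_sum_le n h) _.
by rewrite -[leRHS]invrK lef_pV2 ?posrE; lra.
Qed.

(** This is why a fourth power is bounded: with [n = 2^k], two factors [n] serve the quadratic
    remainder and the others leave the decay [2^(-k)]. *)
Lemma dyadic_exprn_le (rho B : R) k : 0 <= rho -> 0 <= B ->
  (forall n, n%:R ^+ 4 * rho ^+ n <= B) ->
  (2 ^ k)%:R ^+ 2 * rho ^+ (2 ^ k) <= B * 2^-1 ^+ k.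
Proof.
move=> r0 B0 rB; rewrite exprVn ler_pdivlMr ?exprn_gt0//.
apply: le_trans (rB (2 ^ k)%N); rewrite mulrAC ler_wpM2r ?exprn_ge0//.
have n1 : 1 <= (2 ^ k)%:R :> R by rewrite ler1n expn_gt0.
rewrite -[2 ^+ k]natrX (exprD _ 2 2) ler_wpM2l ?exprn_ge0//.
by rewrite -[leLHS]expr1 ler_weXn2l.
Qed.

Lemma lac_deriv_abs z : cabs z < 1 -> exists B,
  abs_bounded (fun k => of_real ((2 / gam) ^+ k) * z ^+ (2 ^ k).-1) B.
Proof.
(* The midpoint of [|z|] and [1] is positive even for [z = 0], so dividing by [rho] can make up for
   the exponent [2^k - 1] in place of [2^k]. *)
move=> z1; pose rho := (1 + cabs z) / 2.
have z0 := cabs_ge0 z.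
have r0 : 0 < rho by rewrite /rho; lra.
have r1 : 0 <= rho < 1 by rewrite /rho; lra.
have zr : cabs z <= rho by rewrite /rho; lra.
have [B B0 rB] := expr4_exprn_le r1; exists (rho^-1 * (B * 2)) => n.
apply: le_trans (_ : \sum_(k < n) rho^-1 * (B * 2^-1 ^+ k) <= _); last first.
  by rewrite -!mulr_sumr !ler_wpM2l ?half_geometric_sum_le// invr_ge0 ltW.
apply: ler_sum => k _; rewrite cabsM cabs_real ger0_norm; last first.
  by rewrite exprn_ge0// divr_ge0// ltW.
rewrite ler_pdivlMl//.
apply: le_trans (dyadic_exprn_le k (ltW r0) B0 rB).
rewrite mulrCA cabsX.
have n1 : 1 <= (2 ^ k)%:R :> R by rewrite ler1n expn_gt0.
apply: ler_pM.
- by rewrite exprn_ge0// divr_ge0// ltW.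
- by rewrite mulr_ge0 ?exprn_ge0// ltW.
- apply: le_trans (_ : 2 ^+ k <= _).
    rewrite lerXn2r ?nnegrE ?divr_ge0 ?(ltW gam_gt0)//.
    by rewrite ler_pdivrMr// ler_peMr// ltW.
  by rewrite -natrX -[leLHS]expr1 ler_weXn2l.
- have e2 : (2 ^ k = (2 ^ k).-1.+1)%N by rewrite prednK ?expn_gt0.
  by rewrite {2}e2 exprS ler_wpM2l ?lerXn2r ?nnegrE// ltW.
Qed.

(** The remainder of the term [z^(2^k)] is at most [(2^k)^2 rho^(2^k - 2) |h|^2], which
    [dyadic_exprn_le] makes summable in [k]; [eta] is chosen so that [z + h] stays in the disc of
    radius [rho]. *)
Lemma lac_derivable z : cabs z < 1 -> derivable lac z 1 /\ derive1 lac z = lac_deriv z.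
Proof.
move=> z1; pose rho := (1 + cabs z) / 2; pose eta := (1 - cabs z) / 2.
have z0 := cabs_ge0 z.
have r0 : 0 < rho by rewrite /rho; lra.
have r1 : 0 <= rho < 1 by rewrite /rho; lra.
have zr : cabs z <= rho by rewrite /rho; lra.
have [B B0 rB] := expr4_exprn_le r1.
apply: (@derivable_of_quadratic _ _ _ _ (2 * ((rho ^+ 2)^-1 * (B * 2))) eta).
  by rewrite /eta; lra.
move=> h hh.
have wr : cabs (z + h) <= rho.
  by apply: le_trans (cabsD _ _) _; move: hh; rewrite /rho /eta; lra.
have w1 : cabs (z + h) <= 1 by move: r1 wr; lra.
rewrite lac_sub//; last exact: ltW.
have [B' zB'] := lac_deriv_abs z1.
pose u k := of_real (gam^-1 ^+ k) * ((z + h) ^+ (2 ^ k) - z ^+ (2 ^ k)).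
have uE : (fun k => of_real (gam^-1 ^+ k) * (z + h) ^+ (2 ^ k) +
    -1 * (of_real (gam^-1 ^+ k) * z ^+ (2 ^ k))) = u.
  by apply/funext => k; rewrite /u mulN1r mulrBr.
have := abs_boundedD (lac_abs w1) (abs_boundedZ (-1) (lac_abs (ltW z1))).
rewrite uE => uB.
rewrite -mulNr -/u -(csumZ (- h) zB') -(csumD uB (abs_boundedZ (- h) zB')).
rewrite -[leRHS]mulrA -[X in _ <= 2 * X]mulrA [B * 2 * _]mulrC.
apply: cabs_csum => n.
apply: le_trans (_ : \sum_(k < n) (rho ^+ 2)^-1 * (cabs h ^+ 2 * (B * 2^-1 ^+ k)) <= _); last first.
  rewrite -!mulr_sumr !ler_wpM2l ?half_geometric_sum_le// ?exprn_ge0 ?cabs_ge0//.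
  by rewrite invr_ge0 exprn_ge0// ltW.
apply: ler_sum => k _.
have -> : u k + - h * (of_real ((2 / gam) ^+ k) * z ^+ (2 ^ k).-1) =
  of_real (gam^-1 ^+ k) * ((z + h) ^+ (2 ^ k) - z ^+ (2 ^ k) -
     ((z + h) - z) * ((2 ^ k)%:R * z ^+ (2 ^ k).-1)).
  rewrite /u [z + h]addrC addrK [RHS]mulrBr; congr (_ + _).
  rewrite exprMn of_realM mulNr; congr (- _).
  have -> : of_real (2 ^+ k) = (2 ^ k)%:R :> Cplx R.
    by rewrite /of_real rmorphXn /= rmorph_nat natrX.
  ring.
rewrite cabsM cabs_real ger0_norm; last by rewrite exprn_ge0// invr_ge0 ltW.
have q := cabs_subX_quadratic (2 ^ k) zr wr.
apply: le_trans (_ : cabs ((z + h) ^+ (2 ^ k) - z ^+ (2 ^ k) -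
     ((z + h) - z) * ((2 ^ k)%:R * z ^+ (2 ^ k).-1)) <= _).
  rewrite ler_piMl ?cabs_ge0// exprn_ile1// ?invr_ge0 ?(ltW gam_gt0)//.
  by rewrite ltW// invf_lt1.
rewrite ler_pdivlMl ?exprn_gt0//; apply: le_trans q _.
rewrite [z + h]addrC addrK mulrC ler_wpM2l ?exprn_ge0 ?cabs_ge0//.
exact: dyadic_exprn_le (ltW r0) B0 rB.
Qed.

End Lacunary.

(** * Chord lengths on the circle *)

Section Trigonometry.
Variable R : realType.
Implicit Types x t h : R.

Lemma sin_le_self h : 0 <= h -> `|sin h| <= h.
Proof.
move=> h0.
have [c _] := MVT_segment h0 (fun x _ => is_derive_sin x)
  (continuous_subspaceT (@continuous_sin R)).
rewrite sin0 !subr0 => ->; rewrite normrM (ger0_norm h0) ler_piMl//.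
exact: cos_max.
Qed.

Lemma one_sub_cos_le h : 0 <= h -> `|cos h - 1| <= h.
Proof.
move=> h0.
have [c _] := MVT_segment h0 (fun x _ => is_derive_cos x)
  (continuous_subspaceT (@continuous_cos R)).
rewrite cos0 !subr0 => ->; rewrite normrM (ger0_norm h0) ler_piMl// normrN.
exact: sin_max.
Qed.

Lemma cabs_expi_sub t h : 0 <= h -> cabs (expi (t + h) - expi t) <= 2 * h.
Proof.
move=> h0.
have -> : expi (t + h) - expi t = expi t * (expi h - 1).
  by rewrite expiD mulrBr mulr1.
rewrite cabsM cabs_expi mul1r; apply: le_trans (cabs_le_ReIm _) _.
by rewrite mulr_natl mulr2n /= subr0 lerD ?one_sub_cos_le ?sin_le_self.
Qed.

(** A weak Jordan inequality. While [cos x >= 1/4] it follows from the mean value theorem, as the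
    cosine decreases; afterwards [sin x >= 1/2], and [x < 2]. *)
Lemma sin_ge_quarter x : 0 <= x <= pi / 2 -> x / 4 <= sin x.
Proof.
move=> /andP[x0 xpi]; have /andP[_ pi2] := @pihalf_02 R.
have pi0 := @pi_gt0 R.
have cx0 : 0 <= cos x by apply: cos_ge0_pihalf; apply/andP; split; lra.
have sx0 : 0 <= sin x by apply: sin_ge0_pi; lra.
have [c /[!in_itv]/= /andP[c0 cx]] := MVT_segment x0 (fun x _ => is_derive_sin x)
  (continuous_subspaceT (@continuous_sin R)).
rewrite sin0 !subr0 => sx.
have cc : cos x <= cos c.
  rewrite leNgt ltr_cos ?in_itv /=; first by rewrite -leNgt.
    by apply/andP; split; lra.
  by apply/andP; split; lra.
have [c4|c4] := leP 4^-1 (cos x).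
  by rewrite sx mulrC ler_wpM2r// (le_trans c4).
have := cos2Dsin2 x => cs.
suff : 2^-1 <= sin x by lra.
rewrite leNgt; apply/negP => s2.
have : cos x ^+ 2 <= 4^-1 * 4^-1 by rewrite expr2 ler_pM// ltW.
have : sin x ^+ 2 <= 2^-1 * 2^-1 by rewrite expr2 ler_pM// ltW.
lra.
Qed.

Lemma cabs_1_sub_expi t : cabs (1 - expi t) = 2 * `|sin (t / 2)|.
Proof.
rewrite cabsE /= sub0r sqrrN.
have -> : (1 - cos t) ^+ 2 + sin t ^+ 2 = (2 * sin (t / 2)) ^+ 2.
  have := cos2Dsin2 t; have := cos2Dsin2 (t / 2).
  have -> : cos t = cos (t / 2) ^+ 2 - sin (t / 2) ^+ 2.
    by rewrite {1}[t]splitr cosD -!expr2.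
  move=> h1 h2; lra.
by rewrite sqrtr_sqr normrM ger0_norm.
Qed.

End Trigonometry.

(** * Membership of the lacunary series in the mean Lipschitz space *)

Section LacunaryLipschitz.
Variables (R : realType) (p : R).
Hypothesis p_gt1 : 1 < p.

(** Chosen so that [gam^p = 2]: then [gam^(-m)] is the [1/p]-th power of the scale [2^(-m)], which
    gives the Hoelder exponent. *)
Definition root2 : R := 2 `^ p^-1.
Notation gam := root2.

Let p_gt0 : 0 < p. Proof. by apply: lt_trans p_gt1. Qed.

Lemma root2_powR : gam `^ p = 2.
Proof. by rewrite -powRrM mulVf ?gt_eqF// powRr1. Qed.

Lemma root2_gt1 : 1 < gam.
Proof.
suff : 1 `^ p^-1 < gam by rewrite powR1.
apply: gt0_ltr_powR; rewrite ?nnegrE ?invr_gt0//.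
by rewrite ltr1n.
Qed.

Lemma root2_lt2 : gam < 2.
Proof.
have g1 := root2_gt1; have g0 : 0 < gam by exact: lt_trans g1.
rewrite -[ltRHS]root2_powR -(mulr_powRB1 (ltW g0) p_gt0) ltr_pMr//.
suff : 1 `^ (p - 1) < gam `^ (p - 1) by rewrite powR1.
apply: gt0_ltr_powR; rewrite ?nnegrE ?subr_gt0//.
exact: ltW.
Qed.

Lemma root2_pow m : gam ^+ m = (2 ^+ m) `^ p^-1.
Proof.
elim: m => [|m IH]; first by rewrite !expr0 powR1.
by rewrite !exprS IH powRM ?exprn_ge0.
Qed.

Lemma lac_analytic : analytic_on_disc (lac gam).
Proof. by move=> z z1; case: (lac_derivable root2_gt1 z1). Qed.

Lemma lac_hardy : hardy p (lac gam).
Proof.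
split; first exact: lac_analytic.
apply: le_lt_trans (ltry (2 * (1 - gam^-1)^-1)).
apply: ge_ereal_sup => _ [r /= /[!in_itv]/= /andP[r0 r1] <-].
have g01 := gamV_01 root2_gt1.
apply: circle_mean_le_sup => //.
  by rewrite mulr_ge0// invr_ge0; lra.
move=> t; apply: (cabs_lac root2_gt1).
by rewrite cabsM cabs_real cabs_expi mulr1 ger0_norm ltW.
Qed.

Lemma gamV_pow_small (e : R) : 0 < e -> exists m, gam^-1 ^+ m < e.
Proof.
move=> e0; have /andP[g0 g1] := gamV_01 root2_gt1.
have : gam^-1 ^+ n @[n --> \oo] --> 0 by apply: cvg_expr; rewrite ger0_norm.
move/cvgrPdist_lt => /(_ e e0) [N _ HN]; exists N.
by have := HN N (leqnn N); rewrite /= sub0r normrN ger0_norm// exprn_ge0.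
Qed.

(** The series converges on the closed disc and [lac_hoelder] holds up to the circle, so the limit
    exists along the whole disc and [lac] is its own boundary function. *)
Lemma lac_nt_limit zeta : cabs zeta = 1 -> nt_limit (lac gam) zeta (lac gam zeta).
Proof.
move=> z1 sigma s1; apply/cvgrPdist_lt => e /gt0_of_real[-> e0].
set e' := complex.Re e in e0 *.
have C0 := hoelder_const_ge0 root2_gt1 root2_lt2.
set C := hoelder_const gam in C0.
have [m me] := gamV_pow_small (divr_gt0 e0 (ltr_wpDl C0 ltr01)).
near=> z.
have [zD _] : stolz sigma zeta z by near: z; exact: withinT.
rewrite norm_cabs ltcR.
have zz : 2 ^+ m * cabs (zeta - z) <= 1.
  rewrite -ler_pdivlMl ?exprn_gt0// mulr1.
  have : `|zeta - z| < of_real (2 ^+ m)^-1.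
    near: z; apply: cvg_within; apply/nbhs_ballP; exists (of_real (2 ^+ m)^-1) => //.
    by rewrite /= ltcR invr_gt0 exprn_gt0.
  by rewrite norm_cabs ltcR => /ltW.
apply: le_lt_trans (lac_hoelder root2_gt1 root2_lt2 _ (ltW zD) zz) _.
  by rewrite z1.
apply: le_lt_trans (_ : (C + 1) * gam^-1 ^+ m < _).
  rewrite ler_wpM2r ?lerDl// exprn_ge0//.
  by have /andP[] := gamV_01 root2_gt1.
by rewrite mulrC -ltr_pdivlMr// ltr_wpDl.
Unshelve. all: by end_near. Qed.

Lemma lac_omega : exists K : R, \forall t \near 0^'+,
  (omega p (lac gam) t <= (K * t `^ p^-1)%:E)%E.
Proof.
(* The chord is at most [2 h]. If [m] is the dyadic scale of [2 h], then [1 < 2^m (4 h)], hence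
   [gam^(-m) <= (4 t)^(1/p)]. Taking [t < 1/2] ensures [2 h <= 1], so that the scale exists. *)
exists (hoelder_const gam * 4 `^ p^-1); near=> t.
have C0 := hoelder_const_ge0 root2_gt1 root2_lt2.
have t0 : 0 < t by near: t; exact: nbhs_right_gt.
have t1 : t < 2^-1 by near: t; apply: nbhs_right_lt; rewrite invr_gt0.
apply: ge_ereal_sup => _ [h /= /[!in_itv]/= /andP[h0 ht] <-].
apply: circle_mean_le_sup => //; first by apply: mulr_ge0 (powR_ge0 _ _); apply: mulr_ge0 C0 (powR_ge0 _ _).
move=> u.
have [m /andP[m1 m2]] : exists m, 2 ^+ m * (2 * h) <= 1 < 2 ^+ m.+1 * (2 * h).
  by apply: dyadic_scale; apply/andP; split; lra.
apply: le_trans (lac_hoelder (m := m) root2_gt1 root2_lt2 _ _ _) _; rewrite ?cabs_expi//.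
  apply: le_trans m1; rewrite ler_wpM2l ?exprn_ge0//.
  by apply: cabs_expi_sub; exact: ltW.
rewrite -mulrA ler_wpM2l// -powRM ?(ltW t0)// exprVn.
rewrite -[leLHS]mulr1 ler_pdivrMl ?exprn_gt0 ?powR_gt0//.
rewrite root2_pow -powRM ?exprn_ge0 ?mulr_ge0 ?(ltW t0)//.
suff : 1 `^ p^-1 <= (2 ^+ m * (4 * t)) `^ p^-1 by rewrite powR1.
apply: ge0_ler_powR; rewrite ?nnegrE ?invr_ge0 ?mulr_ge0 ?exprn_ge0 ?(ltW p_gt0) ?(ltW t0)//.
apply: le_trans (ltW m2) _; rewrite exprSr -mulrA ler_wpM2l ?exprn_ge0//; lra.
Unshelve. all: by end_near. Qed.

Lemma lac_mean_lipschitz : mean_lipschitz p p^-1 (lac gam).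
Proof.
split; first exact: lac_hardy.
exists (lac gam); last exact: lac_omega.
by apply: aeW => t; apply: lac_nt_limit; exact: cabs_expi.
Qed.

End LacunaryLipschitz.

(** * The test functions *)

Section QuadraticDifferentiability.
Variable R : realType.
Implicit Types (f : Cplx R -> Cplx R) (z : Cplx R).

Definition quad_diff f z := exists d B eta, 0 < eta /\
  forall h, cabs h < eta -> cabs (f (z + h) - f z - h * d) <= B * cabs h ^+ 2.

Lemma quad_diff_derivable f z : quad_diff f z -> derivable f z 1.
Proof.
by move=> [d [B [eta [eta0 fB]]]]; case: (derivable_of_quadratic eta0 fB).
Qed.

Lemma quad_diff_sum N (F : nat -> Cplx R -> Cplx R) z :
  (forall j, quad_diff (F j) z) -> quad_diff (fun w => \sum_(j < N) F j w) z.
Proof.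
move=> FB; elim: N => [|N [d [B [eta [eta0 IH]]]]].
  exists 0, 0, 1; split=> // h _.
  by rewrite !big_ord0 mulr0 !subr0 cabs0 mul0r.
have [d' [B' [eta' [eta'0 H]]]] := FB N.
exists (d + d'), (B + B'), (Num.min eta eta'); split; first by rewrite lt_min eta0.
move=> h; rewrite lt_min => /andP[h1 h2]; rewrite !big_ord_recr /=.
set S := \sum_(j < N) _; set T := \sum_(j < N) _.
have -> : S + F N (z + h) - (T + F N z) - h * (d + d') =
  (S - T - h * d) + (F N (z + h) - F N z - h * d') by ring.
apply: le_trans (cabsD _ _) _; rewrite mulrDl.
by apply: lerD; [exact: IH|exact: H].
Qed.

Lemma inv_linear_remainder (F : fieldType) (c a u h : F) :
  u != 0 -> u - a * h != 0 ->
  c * (u - a * h)^-1 - c * u^-1 - h * (c * a * (u^-1) ^+ 2) =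
  h ^+ 2 * (c * a ^+ 2 * (u^-1) ^+ 2 * (u - a * h)^-1).
Proof. by move=> u0 v0; field; rewrite v0. Qed.

(** As [|a| <= 1], the denominator at [z] is at least [delta = 1 - |z|], and an increment below
    [delta / 2] leaves at least [delta / 2]; this bounds the exact remainder of
    [inv_linear_remainder]. *)
Lemma quad_diff_inv_linear (c a z : Cplx R) : cabs a <= 1 -> cabs z < 1 ->
  quad_diff (fun w => c * (1 - a * w)^-1) z.
Proof.
move=> a1 z1; set u := 1 - a * z; pose delta := 1 - cabs z.
have d0 : 0 < delta by rewrite subr_gt0.
have ud : delta <= cabs u.
  rewrite lerBlDr.
  have {1}-> : 1 = cabs (u + a * z) by rewrite subrK cabs1.
  apply: le_trans (cabsD _ _) _; rewrite lerD2l cabsM.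
  by rewrite ler_piMl// cabs_ge0.
exists (c * a * (u^-1) ^+ 2), (cabs c * cabs a ^+ 2 * (cabs u)^-1 ^+ 2 * (delta / 2)^-1), (delta / 2).
split; first by rewrite divr_gt0.
move=> h hd; have -> : 1 - a * (z + h) = u - a * h by rewrite mulrDr opprD addrA.
have vd : delta / 2 <= cabs (u - a * h).
  have : cabs u <= cabs (u - a * h) + cabs h.
    have {1}-> : u = (u - a * h) + a * h by rewrite subrK.
    apply: le_trans (cabsD _ _) _; rewrite lerD2l cabsM.
    by rewrite ler_piMl// cabs_ge0.
  by move: hd ud; lra.
have d20 : 0 < delta / 2 by rewrite divr_gt0.
have u0 : u != 0 by rewrite -cabs_eq0 gt_eqF// (lt_le_trans d0).
have v0 : u - a * h != 0 by rewrite -cabs_eq0 gt_eqF// (lt_le_trans d20).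
rewrite inv_linear_remainder// cabsM cabsX mulrC ler_wpM2r ?exprn_ge0 ?cabs_ge0//.
rewrite cabsM cabsV [cabs (c * _ * _)]cabsM [cabs (c * _)]cabsM !cabsX cabsV.
rewrite ler_wpM2l ?mulr_ge0 ?exprn_ge0 ?invr_ge0 ?cabs_ge0//.
by rewrite lef_pV2 ?posrE// (lt_le_trans d20).
Qed.

End QuadraticDifferentiability.

Section TestFunctions.
Variables (R : realType) (gam : R).
Hypotheses (gam_gt1 : 1 < gam) (gam_lt2 : gam < 2).
Implicit Types z w : Cplx R.

Definition rad (j : nat) : R := 1 - 2^-1 ^+ j.

(** A Cauchy kernel with pole [1 / rad j], about [2^(-j)] outside the disc (a constant for [j = 0]).
    On the circle its size is [gam^j] within distance [2^(-j)] of [1] and [(gam/2)^j / |1 - z|]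
    beyond. *)
Definition test_term j z : Cplx R :=
  of_real ((gam / 2) ^+ j) * (1 - of_real (rad j) * z)^-1.

Definition test_fun N z : Cplx R := \sum_(j < N) test_term j z.

Let gam_gt0 : 0 < gam. Proof. exact: lt_trans ltr01 gam_gt1. Qed.

Lemma half_pow_01 j : 0 <= (2^-1 : R) ^+ j <= 1.
Proof. by rewrite exprn_ge0 ?invr_ge0//= exprn_ile1 ?invr_ge0 ?invf_le1 ?ler1n. Qed.

Lemma rad_01 j : 0 <= rad j <= 1.
Proof. by have := half_pow_01 j; rewrite /rad; lra. Qed.

Lemma cabs_sub_ge (s : R) w : 0 <= s -> cabs w <= 1 ->
  1 - s <= cabs (1 - of_real s * w).
Proof.
move=> s0 w1; rewrite lerBlDr.
have {1}-> : 1 = cabs ((1 - of_real s * w) + of_real s * w) by rewrite subrK cabs1.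
apply: le_trans (cabsD _ _) _; rewrite lerD2l cabsM cabs_real ger0_norm//.
by rewrite ler_piMr.
Qed.

(** Moving from [w] to [s w] shifts the point by [1 - s], which is itself at most [|1 - s w|]. *)
Lemma cabs_sub_ge_half (s : R) w : 0 <= s <= 1 -> cabs w = 1 ->
  cabs (1 - w) / 2 <= cabs (1 - of_real s * w).
Proof.
move=> /andP[s0 s1] w1; rewrite ler_pdivrMr// mulr_natr mulr2n.
have -> : 1 - w = (1 - of_real s * w) - of_real (1 - s) * w.
  have -> : of_real (1 - s) = 1 - of_real s by rewrite of_realB of_real1.
  by rewrite mulrBl mul1r opprB addrA subrK.
apply: le_trans (cabsB _ _) _; rewrite lerD2l cabsM cabs_real w1 mulr1.
by rewrite ger0_norm ?subr_ge0// cabs_sub_ge// w1.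
Qed.

Lemma test_analytic N : analytic_on_disc (test_fun N).
Proof.
move=> z z1; apply: quad_diff_derivable; apply: quad_diff_sum => j.
apply: quad_diff_inv_linear => //; rewrite cabs_real.
by have /andP[r0 r1] := rad_01 j; rewrite ger0_norm.
Qed.

Definition test_const : R := 4 / (1 - tau gam).

(** Either there is no term beyond [m], or [m] is at least the dyadic scale of [|1 - w| / 2]. Terms
    with [j <= m] are bounded by [gam^j], through denominators of at least [2^(-j)]; terms with
    [j > m] use [|1 - w| / 2] instead. Both bounds decay geometrically away from [m]. *)
Lemma cabs_test N m (r : R) w : 0 <= r < 1 -> cabs w = 1 ->
  (N <= m)%N || (1 < 2 ^+ m.+1 * (cabs (1 - w) / 2)) ->
  cabs (test_fun N (of_real r * w)) <= test_const * gam ^+ m.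
Proof.
move=> /andP[r0 r1] w1 Nm.
have [t0 t1] := andP (tau_01 gam_gt1 gam_lt2).
rewrite /test_fun; apply: le_trans (cabs_sum _ (fun j => test_term j (of_real r * w))) _.
apply: le_trans (_ : \sum_(j < N) 2 * gam ^+ m * tau gam ^+ ((j - m) + (m - j)) <= _).
  apply: ler_sum => j _; rewrite /test_term cabsM cabs_real cabsV mulrA -of_realM.
  rewrite ger0_norm ?exprn_ge0 ?divr_ge0 ?(ltW gam_gt0)//.
  set s := rad j * r; have /andP[j0 j1] := rad_01 j.
  have s0 : 0 <= s by rewrite mulr_ge0.
  have sj : s <= rad j by rewrite ler_piMr// ltW.
  have s1 : s <= 1 by rewrite (le_trans sj).
  have lb1 : 2^-1 ^+ j <= cabs (1 - of_real s * w).
    apply: le_trans (cabs_sub_ge s0 _); last by rewrite w1.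
    by move: sj; rewrite /rad; lra.
  have p0 : 0 < (2^-1 : R) ^+ j by rewrite exprn_gt0// invr_gt0.
  have g0 : 0 <= gam ^+ m by rewrite exprn_ge0// ltW.
  rewrite ler_pdivrMr; last by exact: lt_le_trans lb1.
  have [jm|mj] := leqP j m.
    rewrite (eqP jm) add0n.
    apply: le_trans (_ : gam ^+ m * tau gam ^+ (m - j) * 2^-1 ^+ j <= _); last first.
      apply: ler_pM lb1; [by rewrite mulr_ge0// exprn_ge0|exact: ltW|].
      by rewrite -mulrA ler_peMl ?ler1n// mulr_ge0// exprn_ge0.
    rewrite exprMn ler_wpM2r ?(ltW p0)//.
    rewrite -{1}(subnKC jm) exprD -mulrA ler_peMr ?exprn_ge0 ?(ltW gam_gt0)//.
    apply: le_trans (_ : gam ^+ (m - j) * gam^-1 ^+ (m - j) <= _).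
      by rewrite -exprMn mulfV ?gt_eqF// expr1n.
    by rewrite ler_wpM2l ?exprn_ge0 ?(ltW gam_gt0)// tau_gamV.
  have jN : (m < N)%N by exact: ltn_trans mj (ltn_ord j).
  move: Nm; rewrite leqNgt jN /= => dm.
  rewrite (eqP (ltnW mj)) addn0.
  have lb2 : cabs (1 - w) / 2 <= cabs (1 - of_real s * w).
    by apply: cabs_sub_ge_half; rewrite // s0.
  apply: le_trans (_ : 2 * gam ^+ m * tau gam ^+ (j - m) * (cabs (1 - w) / 2) <= _); last first.
    by rewrite ler_wpM2l//; apply: mulr_ge0; rewrite ?exprn_ge0 ?mulr_ge0.
  apply: le_trans (_ : gam ^+ m * tau gam ^+ (j - m) * 2^-1 ^+ m <= _); last first.
    rewrite mulrC -!mulrA mulrCA [leRHS]mulrCA ler_wpM2l//.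
    rewrite mulrC [leRHS]mulrCA ler_wpM2l ?exprn_ge0//.
    rewrite exprVn -[leLHS]mulr1 ler_pdivrMl ?exprn_gt0//.
    by move: dm; rewrite exprSr -mulrA => /ltW.
  have -> : (gam / 2) ^+ j = (gam ^+ m * 2^-1 ^+ m) * (gam / 2) ^+ (j - m).
    by rewrite -exprMn -exprD subnKC// ltnW.
  rewrite [leRHS]mulrAC ler_wpM2l ?tau_gam2// mulr_ge0// exprn_ge0// invr_ge0//.
rewrite -mulr_sumr; apply: le_trans (ler_wpM2l _ (two_sided_geometric_sum_le m N (tau_01 gam_gt1 gam_lt2))) _.
  by rewrite mulr_ge0// exprn_ge0// ltW.
by rewrite /test_const le_eqVlt; apply/orP; left; apply/eqP; ring.
Qed.

End TestFunctions.

(** * Hardy norm of the test functions *)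

Section TestNorm.
Variables (R : realType) (p : R).
Hypothesis p_gt1 : 1 < p.
Notation gam := (root2 p).
Notation mu := (@lebesgue_measure R).

Let p_gt0 : 0 < p. Proof. by apply: lt_trans p_gt1. Qed.
Let gam_gt1 : 1 < gam := root2_gt1 p_gt1.
Let gam_lt2 : gam < 2 := root2_lt2 p_gt1.

(** The point [1] sits at both ends of the parameter interval. The [8] comes from
    [|1 - expi t| / 2 = |sin (t / 2)|] and [sin x >= x / 4]. *)
Definition near_one (j : nat) : set R :=
  `[0, 8 * 2^-1 ^+ j] `|` `[2 * pi - 8 * 2^-1 ^+ j, 2 * pi].

Lemma measurable_near_one j : measurable (near_one j).
Proof. by apply: measurableU; exact: measurable_itv. Qed.

Lemma mu_near_one j : (mu (near_one j) <= (16 * 2^-1 ^+ j)%:E)%E.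
Proof.
have h0 : 0 < 8 * (2^-1 : R) ^+ j by rewrite mulr_gt0// exprn_gt0// invr_gt0.
apply: le_trans (measureU2 _ _ _) _; [exact: measurable_itv|exact: measurable_itv|].
rewrite /= !lebesgue_measure_itv /= !lte_fin h0 ltrBlDr ltrDl h0 /= -!EFinB -EFinD lee_fin.
lra.
Qed.

Lemma near_oneP j (t : R) : 0 <= t <= 2 * pi ->
  2 ^+ j * (cabs (1 - expi t) / 2) <= 1 -> near_one j t.
Proof.
move=> /andP[t0 tpi]; rewrite cabs_1_sub_expi mulrAC divff// mul1r => h.
have pi0 := @pi_gt0 R.
have sj : `|sin (t / 2)| <= 2^-1 ^+ j.
  by rewrite exprVn -[leRHS]mulr1 ler_pdivlMl// exprn_gt0.
rewrite /near_one; have [tp|pt] := leP t pi; [left|right] => /=; rewrite in_itv /=.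
  rewrite t0 /=.
  have := @sin_ge_quarter _ (t / 2); have := ler_norm (sin (t / 2)).
  have H : 0 <= t / 2 <= pi / 2 by apply/andP; split; lra.
  by move=> h1 /(_ H) h2; lra.
rewrite tpi andbT.
(* For [t > pi] the reflected angle has the same sine and lies in [[0, pi / 2]]. *)
have := @sin_ge_quarter _ (pi - t / 2).
have -> : sin (pi - t / 2) = sin (t / 2).
  by rewrite sinB sinpi cospi mul0r sub0r mulN1r opprK.
have H : 0 <= pi - t / 2 <= pi / 2 by apply/andP; split; lra.
have := ler_norm (sin (t / 2)).
by move=> h1 /(_ H) h2; lra.
Qed.

(** [m] is the dyadic scale of the distance to [1], cut off at [N]; the identity [gam^p = 2] turns
    [gam^m] into [2^m]. *)
Lemma powR_test_le N (r t : R) : 0 <= r < 1 -> 0 <= t <= 2 * pi ->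
  exists2 m, (m < N.+1)%N & near_one m t /\
    cabs (test_fun gam N (of_real r * expi t)) `^ p <= test_const gam `^ p * 2 ^+ m.
Proof.
move=> r01 t02; set d := cabs (1 - expi t) / 2.
have d0 : 0 <= d by rewrite divr_ge0 ?cabs_ge0.
have d1 : d <= 1.
  by rewrite ler_pdivrMr// mul1r (le_trans (cabsB _ _))// cabs1 cabs_expi.
have C0 : 0 <= test_const gam.
  by have /andP[_ t1] := tau_01 gam_gt1 gam_lt2; rewrite divr_ge0// subr_ge0 ltW.
have key m : (N <= m)%N || (1 < 2 ^+ m.+1 * d) ->
    cabs (test_fun gam N (of_real r * expi t)) `^ p <= test_const gam `^ p * 2 ^+ m.
  move=> Nm; have g0 : 0 <= gam ^+ m by rewrite exprn_ge0// powR_ge0.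
  have -> : 2 ^+ m = (gam ^+ m) `^ p :> R.
    by rewrite root2_pow -powRrM mulVf ?gt_eqF// powRr1// exprn_ge0.
  rewrite -powRM//; apply: ge0_ler_powR; rewrite ?nnegrE ?(ltW p_gt0) ?cabs_ge0 ?(mulr_ge0 C0 g0)//.
  exact: (cabs_test gam_gt1 gam_lt2 r01 (cabs_expi t) Nm).
have [dN|dN] := leP (2 ^+ N * d) 1.
  exists N => //; split; first exact: near_oneP.
  by apply: key; rewrite leqnn.
have dp : 0 < d <= 1.
  rewrite d1 andbT lt_neqAle d0 andbT eq_sym; apply/eqP => d00.
  by move: dN; rewrite d00 mulr0 ltr10.
have [m /andP[m1 m2]] := dyadic_scale dp.
exists m; last by split; [exact: near_oneP|apply: key; rewrite m2 orbT].
rewrite ltnS leqNgt; apply/negP => Nm.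
have : 2 ^+ N * d <= 2 ^+ m * d by rewrite ler_wpM2r// ler_weXn2l ?ler1n// ltnW.
by move=> /le_trans/(_ m1); rewrite leNgt dN.
Qed.

(** At each level the height [2^j] cancels the measure [16 / 2^j] of [near_one j], so all [N + 1]
    levels contribute equally: the source of the growth [N^(1/p)]. *)
Lemma circle_mean_test N (r : R) : 0 <= r < 1 ->
  (circle_mean p (fun t => test_fun gam N (of_real r * expi t)) <=
   ((16 * test_const gam `^ p * N.+1%:R) `^ p^-1)%:E)%E.
Proof.
move=> r01.
pose c j := test_const gam `^ p * 2 ^+ j.
have c0 j : 0 <= c j by rewrite mulr_ge0 ?powR_ge0 ?exprn_ge0.
apply: (@circle_mean_le _ _ _
  (fun t => \sum_(j < N.+1) (c j)%:E * (\1_(near_one j) t)%:E)%E) => //.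
- by rewrite !mulr_ge0 ?powR_ge0.
- move=> t t02; have [m mN [tm le]] := powR_test_le N r01 t02.
  under eq_bigr do rewrite -EFinM.
  rewrite sumEFin lee_fin; apply: le_trans le _.
  rewrite (bigD1 (Ordinal mN)) //= indicE mem_set// mulr1 lerDl.
  by apply: sumr_ge0 => j _; rewrite mulr_ge0.
- rewrite ge0_integral_sum//; last 2 first.
  + move=> j; apply: measurable_funeM; apply/measurable_EFinP.
    by apply: measurable_indic; exact: measurable_near_one.
  + by move=> j t _; rewrite -EFinM lee_fin mulr_ge0.
  apply: le_trans (_ : (\sum_(j < N.+1) (16 * test_const gam `^ p)%:E <= _)%E).
    apply: lee_sum => j _; rewrite ge0_integralZl_EFin//; last first.
      apply/measurable_EFinP; apply: measurable_indic; exact: measurable_near_one.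
    rewrite integral_indic//; last exact: measurable_near_one.
    apply: le_trans (_ : ((c j)%:E * (16 * 2^-1 ^+ j)%:E <= _)%E).
      rewrite lee_wpmul2l ?lee_fin//; apply: le_trans (mu_near_one j).
      apply: le_measure; rewrite ?inE//; last exact: measurable_near_one.
      by apply: measurableI => //; exact: measurable_near_one.
    rewrite -EFinM lee_fin /c le_eqVlt; apply/orP; left; apply/eqP.
    by rewrite mulrACA -exprMn divff// expr1n mulr1 mulrC.
  rewrite sumEFin lee_fin sumr_const card_ord -[_ *+ N.+1]mulr_natr.
  rewrite ler_peMl ?mulr_ge0 ?powR_ge0//.
  by have := @pi_ge2 R; lra.
Qed.

Definition test_norm_const : R := (16 * test_const gam `^ p) `^ p^-1.

Lemma hardy_norm_test N :
  (hardy_norm p (test_fun gam N) <= (test_norm_const * N.+1%:R `^ p^-1)%:E)%E.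
Proof.
apply: ge_ereal_sup => _ [r /= /[!in_itv]/= /andP[r0 r1] <-].
rewrite /test_norm_const -powRM ?mulr_ge0 ?powR_ge0//.
by apply: circle_mean_test; rewrite ltW.
Qed.

Lemma test_hardy N : hardy p (test_fun gam N).
Proof.
split; first exact: test_analytic.
exact: le_lt_trans (hardy_norm_test N) (ltry _).
Qed.

End TestNorm.

(** * The generalized Hilbert operator on the test functions *)

Section LebesgueIntegrals.
Variable R : realType.
Notation mu := (@lebesgue_measure R).
Local Notation D := (`[0%R, 1%R[%classic : set R).

Lemma Rintegral_sum (i : interval R) n (f : nat -> R -> R) :
  (forall k, mu.-integrable [set` i] (EFin \o f k)) ->
  mu.-integrable [set` i] (EFin \o (fun t => \sum_(k < n) f k t)) /\
  \int[mu]_(t in [set` i]) (\sum_(k < n) f k t) =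
    \sum_(k < n) \int[mu]_(t in [set` i]) f k t.
Proof.
move=> fi; have mi : measurable [set` i] by exact: measurable_itv.
elim: n => [|n [IHi IH]].
  have -> : (fun t => \sum_(k < 0) f k t) = cst 0 by apply/funext => t; rewrite big_ord0.
  split; first exact: integrable0.
  rewrite big_ord0 /Rintegral; under eq_integral do rewrite /=.
  by rewrite integral0.
have -> : (fun t => \sum_(k < n.+1) f k t) = (fun t => \sum_(k < n) f k t + f n t).
  by apply/funext => t; rewrite big_ord_recr.
split; last by rewrite RintegralD// IH big_ord_recr.
by have := integrableD _ IHi (fi n); apply; exact: measurable_itv.
Qed.

Lemma integral_monomial (c : R) (m : nat) :
  (\int[mu]_(t in `[0%R, 1%R[) (c * t ^+ m)%:E = (c / m.+1%:R)%:E)%E.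
Proof.
have cont (f : R -> R) : f = (fun t => c * t ^+ m) -> continuous f.
  by move=> -> t; apply: cvgM; [exact: cvg_cst|exact: exprn_continuous].
rewrite integral_itv_bndo_bndc; last first.
  by apply/measurable_EFinP; apply: measurable_funM.
pose P (t : R) := c / m.+1%:R * t ^+ m.+1.
have dP (x : R) : is_derive x 1 P (c * x ^+ m).
  have -> : P = (c / m.+1%:R) \*: (id ^+ m.+1).
    by apply/funext => t; rewrite /P exprfctE.
  apply: is_derive_eq; rewrite /= /GRing.scale /= mulr1 mulrA.
  by rewrite divfK// pnatr_eq0.
rewrite (@continuous_FTC2 _ _ P)//.
- by rewrite /P expr1n expr0n /= mulr0 mulr1 sube0.
- by apply: continuous_subspaceT; exact: cont.
- split.
  + by move=> x _; apply: ex_derive; exact: dP.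
  + apply: cvg_at_right_filter; apply: cvgM; [exact: cvg_cst|exact: exprn_continuous].
  + apply: cvg_at_left_filter; apply: cvgM; [exact: cvg_cst|exact: exprn_continuous].
- by move=> x _; rewrite derive1E; apply: derive_val.
Qed.

(** The sum of the [b k] may blow up at the endpoint [1], as it does for [lac_deriv]. So [|F Phi|]
    is compared with [S] times that sum in the extended reals, and monotone convergence integrates
    the sum term by term. *)
Lemma dominated_series_integral (F Phi : R -> R) (phi b : nat -> R -> R) (S B : R) :
  measurable_fun D F -> (forall t, D t -> 0 <= F t <= S) ->
  (forall k, measurable_fun D (phi k)) -> (forall k, measurable_fun D (b k)) ->
  (forall k t, D t -> `|phi k t| <= b k t) ->
  (forall t, D t -> (fun n => \sum_(k < n) phi k t) @ \oo --> Phi t) ->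
  (forall n, (\sum_(k < n) \int[mu]_(t in D) (b k t)%:E <= B%:E)%E) ->
  mu.-integrable D (EFin \o (fun t => F t * Phi t)) /\
  `|\int[mu]_(t in D) (F t * Phi t)| <= S * B.
Proof.
move=> mF FS mphi mb phib phiP bB.
have mD : measurable D by exact: measurable_itv.
have S0 : 0 <= S.
  have /FS /andP[a b'] : D 0 by rewrite /= in_itv /= lexx ltr01.
  exact: le_trans b'.
have b0 k t : D t -> 0 <= b k t by move=> Dt; apply: le_trans (phib k t Dt).
have mPhi : measurable_fun D Phi.
  apply: (@measurable_fun_cvg _ _ _ _ (fun n t => \sum_(k < n) phi k t)) => // n.
  by apply: measurable_sum.
have mFP : measurable_fun D (fun t => F t * Phi t) by exact: measurable_funM.
have le1 t : D t -> (`|(F t * Phi t)%:E| <= S%:E * \sum_(k <oo) (b k t)%:E)%E.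
  move=> Dt; have /andP[F0 FS'] := FS t Dt.
  rewrite /= normrM EFinM; apply: lee_pmul; rewrite ?lee_fin ?normr_ge0 ?(ger0_norm F0)//.
  have h : (`|\sum_(k < n) phi k t|)%:E @[n --> \oo] --> (`|Phi t|)%:E.
    by apply: cvg_EFin; [exact: nearW|apply: cvg_norm; exact: phiP].
  rewrite -(cvg_lim _ h)//; apply: lime_le; first by apply/cvg_ex; eexists; exact: h.
  near=> n; apply: le_trans (nneseries_lim_ge n _); last by move=> k _ _; rewrite lee_fin b0.
  rewrite sumEFin lee_fin big_mkord; apply: le_trans (ler_norm_sum _ _ _) _.
  by apply: ler_sum => k _; exact: phib.
have le2 : (\int[mu]_(t in D) `|(F t * Phi t)%:E| <= (S * B)%:E)%E.
  apply: (@le_trans _ _ (\int[mu]_(t in D) (S%:E * \sum_(k <oo) (b k t)%:E))%E).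
    by apply: ge0_integral_mono => // t _; exact: abse_ge0.
  rewrite ge0_integralZl//; last 2 first.
  - apply: ge0_emeasurable_sum => //; last by move=> k _; apply/measurable_EFinP; exact: mb.
    by move=> k t Dt _; rewrite lee_fin b0.
  - by move=> t Dt; apply: nneseries_ge0 => k _ _; rewrite lee_fin b0.
  rewrite EFinM lee_wpmul2l ?lee_fin//.
  have mbE k : measurable_fun D (fun t => (b k t)%:E) by apply/measurable_EFinP; exact: mb.
  have b0E k t : D t -> (0 <= (b k t)%:E)%E by move=> Dt; rewrite lee_fin b0.
  rewrite integral_nneseries//.
  apply: lime_le.
    apply: is_cvg_nneseries => k _ _; apply: integral_ge0 => t Dt.
    by rewrite lee_fin b0.
  by apply: nearW => n; rewrite big_mkord.
have iFP : mu.-integrable D (EFin \o (fun t => F t * Phi t)).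
  apply/integrableP; split; first exact/measurable_EFinP.
  exact: le_lt_trans le2 (ltry _).
split => //; rewrite -lee_fin EFin_normr_Rintegral//.
apply: le_trans le2; apply: le_abse_integral => //; exact/measurable_EFinP.
Unshelve. all: by end_near. Qed.

End LebesgueIntegrals.

(** * Moments of the test functions *)

Section HilbertExpansion.
Variables (R : realType) (gam : R).
Hypothesis gam_gt1 : 1 < gam.
Implicit Types z w : Cplx R.
Notation mu := (@lebesgue_measure R).
Local Notation D := (`[0%R, 1%R[%classic : set R).

Let gam_gt0 : 0 < gam. Proof. exact: lt_trans ltr01 gam_gt1. Qed.

Definition test_real N (t : R) : R :=
  \sum_(j < N) (gam / 2) ^+ j / (1 - rad R j * t).

Lemma test_of_real N t : test_fun gam N (of_real t) = of_real (test_real N t).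
Proof.
rewrite /test_real (of_real_sum N (fun j => (gam / 2) ^+ j / (1 - rad R j * t))).
by apply: eq_bigr => j _; rewrite /test_term of_realM of_realV (of_realB 1 (_ * _)) of_realM of_real1.
Qed.

Lemma test_real_denom j t : 0 <= t < 1 -> 2^-1 ^+ j <= 1 - rad R j * t.
Proof.
move=> /andP[t0 t1]; have /andP[r0 r1] := rad_01 R j.
have : rad R j * t <= rad R j by rewrite ler_piMr// ltW.
by rewrite {2}/rad; lra.
Qed.

Let half_gt0 j : 0 < (2^-1 : R) ^+ j.
Proof. by rewrite exprn_gt0// invr_gt0. Qed.

Lemma test_real_term_ge0 j t : 0 <= t < 1 -> 0 <= (gam / 2) ^+ j / (1 - rad R j * t).
Proof.
move=> t01; apply: divr_ge0; first by rewrite exprn_ge0// divr_ge0// ltW.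
exact: le_trans (ltW (half_gt0 j)) (test_real_denom j t01).
Qed.

Definition test_real_sup N : R := gam ^+ N / (gam - 1).

Lemma test_real_bounds N t : 0 <= t < 1 -> 0 <= test_real N t <= test_real_sup N.
Proof.
move=> t01; apply/andP; split.
  by apply: sumr_ge0 => j _; exact: test_real_term_ge0.
have g1 : 0 < gam - 1 by rewrite subr_gt0.
apply: le_trans (_ : \sum_(j < N) gam ^+ j <= _).
  apply: ler_sum => j _; have d := test_real_denom j t01.
  rewrite ler_pdivrMr; last exact: lt_le_trans d.
  rewrite exprMn ler_wpM2l ?exprn_ge0 ?(ltW gam_gt0)//.
by rewrite /test_real_sup ler_pdivlMr// mulrC -subrX1 gerBl.
Qed.

Lemma measurable_test_real N : measurable_fun D (test_real N).
Proof.
apply: measurable_sum => j.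
apply: subspace_continuous_measurable_fun; first exact: measurable_itv.
apply: continuous_in_subspaceT => t; rewrite inE /= in_itv /= => t01.
apply: cvgM; first exact: cvg_cst.
apply: cvgV; first by rewrite gt_eqF// (lt_le_trans (half_gt0 j))// test_real_denom.
by apply: cvgB; [exact: cvg_cst|apply: cvgM; [exact: cvg_cst|exact: cvg_id]].
Qed.

Lemma integrable_test_real N m :
  mu.-integrable D (EFin \o (fun t => test_real N t * t ^+ m)).
Proof.
have mD : measurable D by exact: measurable_itv.
have mX : measurable_fun D (fun t : R => t ^+ m) by exact: measurable_funX.
(* A series whose only nonzero term has index [0]. *)
have [] := @dominated_series_integral R (test_real N) (fun t => t ^+ m)
  (fun k t => if k == 0%N then t ^+ m else 0) (fun k t => if k == 0%N then 1 else 0)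
  (test_real_sup N) 1 => //.
- exact: measurable_test_real.
- by move=> t; rewrite /= in_itv /=; exact: test_real_bounds.
- by case=> [|k] /=; [exact: mX|exact: measurable_cst].
- move=> [|k] t; rewrite /= in_itv /= => /andP[t0 t1]; last by rewrite normr0.
  by rewrite ger0_norm ?exprn_ge0// exprn_ile1// ltW.
- move=> t _; apply/cvgrPdist_lt => e e0; near=> n.
  have n0 : (0 < n)%N by near: n; exact: nbhs_infty_gt.
  rewrite -(prednK n0) big_ord_recl /= big1 ?addr0; last by [].
  by rewrite subrr normr0.
- move=> [|n]; first by rewrite big_ord0 lee_fin.
  rewrite big_ord_recl /= big1 ?adde0; last by move=> k _; exact: integral0.
  by rewrite integral_cst//= lebesgue_measure_itv /= lte_fin ltr01 sube0 mule1.
Unshelve. all: by end_near. Qed.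

(** The factor [(2 / gam) ^+ k] is the coefficient of [z^(2^k - 1)] in the derivative of [lac]. *)
Definition coef N k : R :=
  (2 / gam) ^+ k * \int[mu]_(t in D) (test_real N t * t ^+ (2 ^ k).-1).

Lemma one_sub_exprn_le (t : R) m : 0 <= t <= 1 -> 1 - t ^+ m <= m%:R * (1 - t).
Proof.
move=> /andP[t0 t1]; elim: m => [|m IH]; first by rewrite expr0 subrr mul0r.
have -> : 1 - t ^+ m.+1 = (1 - t ^+ m) + t ^+ m * (1 - t) by rewrite exprSr; ring.
rewrite -natr1 mulrDl mul1r lerD// ler_piMl ?subr_ge0// exprn_ile1//.
Qed.

(** With [n = 2^k], only [t >= 1 - 1/(2n)] and the term [j = k] are kept; all terms are nonnegative.
    There [t^(n-1) >= 1/2] by Bernoulli and the denominator is at most [2/n], so the integrand is at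
    least [(gam/2)^k n/4] on a length [1/(2n)]. *)
Lemma coef_ge N k : (k < N)%N -> 8^-1 <= coef N k.
Proof.
move=> kN; set n : R := 2 ^+ k.
have n1 : 1 <= n by rewrite exprn_ege1// ler1n.
have n0 : 0 < n by apply: lt_le_trans n1.
set m := (2 ^ k).-1.
have mn : m%:R <= n by rewrite /n -natrX ler_nat leq_pred.
set f := fun t : R => test_real N t * t ^+ m.
pose a : R := 1 - (2 * n)^-1.
have a0 : 0 <= a.
  by rewrite subr_ge0 invf_le1 ?mulr_gt0//; lra.
have a1 : a < 1 by rewrite ltrBlDr ltrDl invr_gt0 mulr_gt0.
pose c := (gam / 2) ^+ k * (n / 4).
have c0 : 0 <= c by rewrite mulr_ge0 ?exprn_ge0 ?divr_ge0 ?(ltW gam_gt0)// ltW.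
have f0 t : D t -> 0 <= f t.
  rewrite /= in_itv /= => t01; have /andP[F0 _] := test_real_bounds N t01.
  by rewrite mulr_ge0// exprn_ge0//; case/andP: t01.
have fc t : a <= t < 1 -> c <= f t.
  move=> /andP[at1 t1]; have t0 : 0 <= t by exact: le_trans at1.
  have t01 : 0 <= t < 1 by rewrite t0.
  have nt : 1 - t <= (2 * n)^-1 by move: at1; rewrite /a; lra.
  have nV : n * (2 * n)^-1 = 2^-1 by rewrite invfM mulrCA divff ?gt_eqF// mulr1.
  have half : 2^-1 <= t ^+ m.
    have := @one_sub_exprn_le t m _; rewrite t0 (ltW t1) => /(_ isT) h.
    have : m%:R * (1 - t) <= n * (2 * n)^-1.
      by apply: ler_pM => //; rewrite subr_ge0 ltW.
    rewrite nV; lra.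
  rewrite /c mulrC -mulrA; apply: le_trans (_ : ((gam / 2) ^+ k * (n / 2)) * 2^-1 <= _).
    by rewrite le_eqVlt; apply/orP; left; apply/eqP; field.
  apply: ler_pM; rewrite ?mulr_ge0 ?exprn_ge0 ?divr_ge0 ?(ltW gam_gt0) ?(ltW n0) ?invr_ge0//.
  apply: le_trans (_ : (gam / 2) ^+ k / (1 - rad R k * t) <= _); last first.
    rewrite /test_real (bigD1 (Ordinal kN)) //= lerDl.
    by apply: sumr_ge0 => j _; exact: test_real_term_ge0.
  have dpos := lt_le_trans (half_gt0 k) (test_real_denom k t01).
  rewrite ler_wpM2l ?exprn_ge0 ?divr_ge0 ?(ltW gam_gt0)//.
  rewrite -[leLHS]invrK lef_pV2 ?posrE// ?invr_gt0 ?divr_gt0//.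
  rewrite invf_div.
  have : 1 - rad R k * t <= (1 - t) + n^-1.
    rewrite /rad exprVn -/n mulrBl mul1r opprB addrA addrAC lerD2l.
    by rewrite ler_piMr ?invr_ge0 ?ltW.
  move: nt; rewrite invfM => nt h; apply: le_trans h _.
  have : 0 < n^-1 by rewrite invr_gt0.
  lra.
have If : c * (2 * n)^-1 <= \int[mu]_(t in D) f t.
  have iff := integrable_test_real N m.
  rewrite -lee_fin /Rintegral fineK; last by apply: integrable_fin_num => //; exact: measurable_itv.
  apply: le_trans (_ : (\int[mu]_(t in `[a, 1%R[) (f t)%:E <= _)%E).
    have -> : ((c * (2 * n)^-1)%:E = \int[mu]_(t in `[a, 1%R[) (cst c%:E t))%E.
      rewrite integral_cst; last exact: measurable_itv.
      by rewrite /= lebesgue_measure_itv /= lte_fin a1 -EFinB -EFinM /a opprB addrC subrK.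
    apply: ge0_integral_mono => t; rewrite /= in_itv /= lee_fin// => t01.
    exact: fc.
  apply: ge0_subset_integral; [exact: measurable_itv|exact: measurable_itv| | |].
  - by case/integrableP: iff.
  - by move=> t Dt; rewrite lee_fin; exact: f0.
  - by move=> t; rewrite /= !in_itv /= => /andP[h1 ->]; rewrite (le_trans a0).
rewrite /coef; apply: le_trans (_ : (2 / gam) ^+ k * (c * (2 * n)^-1) <= _).
  have e : (2 / gam) ^+ k * (gam / 2) ^+ k = 1.
    by rewrite -exprMn mulrA divfK ?gt_eqF// divff// expr1n.
  rewrite /c -[_ * (n / 4) * _]mulrA [leRHS]mulrA e mul1r.
  by rewrite le_eqVlt; apply/orP; left; apply/eqP; field; rewrite gt_eqF.
by rewrite ler_wpM2l// exprn_ge0// divr_ge0// ltW.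
Qed.

End HilbertExpansion.

Section HilbertExpansionTail.
Variables (R : realType) (gam : R).
Hypothesis gam_gt1 : 1 < gam.
Implicit Types z w : Cplx R.
Notation mu := (@lebesgue_measure R).
Local Notation D := (`[0%R, 1%R[%classic : set R).

Let gam_gt0 : 0 < gam. Proof. exact: lt_trans ltr01 gam_gt1. Qed.

(** [test_real_sup] times the sum of [gam^(-k)] over [k >= N]: the powers [gam^N] cancel, so the
    bound is uniform in [N]. *)
Definition tail_const : R := ((gam - 1) * (1 - gam^-1))^-1.

(* [rho] stands for the real or the imaginary part. *)
Lemma hilbert_part (rho : Cplx R -> R) N z :
  (forall u v, rho (u + v) = rho u + rho v) ->
  (forall x u, rho (of_real x * u) = x * rho u) ->
  (forall u, `|rho u| <= cabs u) ->
  (forall u B, abs_bounded u B ->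
     (fun n => \sum_(k < n) rho (u k)) @ \oo --> rho (csum u)) ->
  cabs z < 1 ->
  exists2 T, `|T| <= tail_const &
    \int[mu]_(t in D) rho (test_fun gam N (of_real t) * derive1 (lac gam) (of_real t * z)) =
    \sum_(k < N) coef gam N k * rho (z ^+ (2 ^ k).-1) + T.
Proof.
move=> rhoD rhoZ rho_le rho_csum z1.
have rho0 : rho 0 = 0 by rewrite -[X in rho X](mul0r 0) -[X in X * _]/(of_real 0) rhoZ mul0r.
have rho_sum n (u : nat -> Cplx R) : rho (\sum_(k < n) u k) = \sum_(k < n) rho (u k).
  by elim: n => [|n IH]; rewrite ?big_ord0// !big_ord_recr /= rhoD IH.
have mD : measurable D by exact: measurable_itv.
pose u (t : R) k := of_real ((2 / gam) ^+ k) * (of_real t * z) ^+ (2 ^ k).-1.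
have rho_u t k : rho (u t k) = (2 / gam) ^+ k * t ^+ (2 ^ k).-1 * rho (z ^+ (2 ^ k).-1).
  by rewrite /u [(of_real t * z) ^+ _]exprMn -of_realX !rhoZ mulrA.
pose phi k t := (2 / gam) ^+ (N + k) * t ^+ (2 ^ (N + k)).-1 * rho (z ^+ (2 ^ (N + k)).-1).
pose b k t := (2 / gam) ^+ (N + k) * t ^+ (2 ^ (N + k)).-1.
pose Phi t := rho (csum (fun k => u t (N + k)%N)).
have g20 k : 0 <= (2 / gam) ^+ k by rewrite exprn_ge0// divr_ge0// ltW.
have tz t : D t -> cabs (of_real t * z) < 1.
  rewrite /= in_itv /= => /andP[t0 t1]; rewrite cabsM cabs_real ger0_norm//.
  by apply: le_lt_trans z1; rewrite ler_piMl ?cabs_ge0// ltW.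
have mX m : measurable_fun D (fun t : R => t ^+ m) by exact: measurable_funX.
have mb k : measurable_fun D (b k).
  by apply: measurable_funM; [exact: measurable_cst|exact: mX].
have gV := gamV_01 gam_gt1.
(* The frequencies with [k >= N] are only estimated: there [(2/gam)^k t^(2^k - 1)] has integral
   [gam^(-k)]. *)
have [iT leT] : mu.-integrable D (EFin \o (fun t => test_real gam N t * Phi t)) /\
    `|\int[mu]_(t in D) (test_real gam N t * Phi t)| <=
    test_real_sup gam N * (gam^-1 ^+ N * (1 - gam^-1)^-1).
  apply: (@dominated_series_integral R (test_real gam N) Phi phi b) => //.
  - exact: measurable_test_real.
  - by move=> t; rewrite /= in_itv /=; exact: test_real_bounds.
  - move=> k; apply: measurable_funM; [exact: mb|exact: measurable_cst].
  - move=> k t; rewrite /= in_itv /= => /andP[t0 _].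
    have b0 : 0 <= b k t by rewrite mulr_ge0// exprn_ge0.
    rewrite normrM (ger0_norm b0) ler_piMr//; apply: le_trans (rho_le _) _.
    by rewrite cabsX exprn_ile1 ?cabs_ge0// ltW.
  - move=> t Dt; have [B uB] := lac_deriv_abs gam_gt1 (tz t Dt).
    have := rho_csum _ _ (abs_boundedS N uB).
    suff -> : (fun n => \sum_(k < n) phi k t) =
       (fun n => \sum_(k < n) rho (u t (N + k)%N)) by [].
    by apply/funext => n; apply: eq_bigr => k _; rewrite rho_u.
  - move=> n.
    have -> : (\sum_(k < n) \int[mu]_(t in D) (b k t)%:E =
               \sum_(k < n) (gam^-1 ^+ N * gam^-1 ^+ k)%:E)%E.
      apply: eq_bigr => k _; rewrite integral_monomial prednK ?expn_gt0//.
      rewrite natrX -exprD -expr_div_n; congr ((_ ^+ _)%:E).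
      by rewrite mulrC mulrA mulVf// mul1r.
    rewrite sumEFin lee_fin -mulr_sumr ler_wpM2l ?geometric_sum_le//.
    by rewrite exprn_ge0//; case/andP: gV.
pose f k t := (2 / gam) ^+ k * rho (z ^+ (2 ^ k).-1) * (test_real gam N t * t ^+ (2 ^ k).-1).
have iF k : mu.-integrable D (EFin \o (fun t => test_real gam N t * t ^+ (2 ^ k).-1)).
  exact: integrable_test_real.
have fi k : mu.-integrable D (EFin \o f k).
  have := integrableZl _ ((2 / gam) ^+ k * rho (z ^+ (2 ^ k).-1)) (iF k).
  by apply; exact: measurable_itv.
have [iG IG] := Rintegral_sum N fi.
have {}IG : \int[mu]_(t in D) (\sum_(k < N) f k t) =
    \sum_(k < N) coef gam N k * rho (z ^+ (2 ^ k).-1).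
  rewrite IG; apply: eq_bigr => k _; rewrite /f RintegralZl//.
  by rewrite /coef mulrAC.
exists (\int[mu]_(t in D) (test_real gam N t * Phi t)).
  apply: le_trans leT _; rewrite /test_real_sup /tail_const exprVn invfM.
  by rewrite mulrACA divff ?mul1r// gt_eqF// exprn_gt0.
rewrite -IG -RintegralD//; apply: eq_Rintegral => t; rewrite inE => Dt.
have [_ ->] := lac_derivable gam_gt1 (tz t Dt).
have [B uB] := lac_deriv_abs gam_gt1 (tz t Dt).
rewrite /lac_deriv (csum_split N uB) test_of_real rhoZ rhoD (rho_sum N (u t)) mulrDr mulr_sumr.
congr (_ + _); apply: eq_bigr => k _; rewrite (rho_u t k) /f.
ring.
Qed.

Lemma hilbert_expansion N z : cabs z < 1 ->
  exists2 T : Cplx R, cabs T <= 2 * tail_const &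
    hilbert_op (lac gam) (test_fun gam N) z =
    \sum_(k < N) of_real (coef gam N k) * z ^+ (2 ^ k).-1 + T.
Proof.
move=> z1.
have [A A1 AE] := hilbert_part N (@ReD R) (@ReMr R) (@Re_le_cabs R) (@csum_cvgRe R) z1.
have [B B1 BE] := hilbert_part N (@ImD R) (@ImMr R) (@Im_le_cabs R) (@csum_cvgIm R) z1.
exists (A +i* B).
  by rewrite mulr_natl mulr2n (le_trans (cabs_le_ReIm _))//= lerD.
apply: complex_eq; rewrite ?ReD ?ImD /=.
  rewrite (Re_sum N (fun k => of_real (coef gam N k) * z ^+ (2 ^ k).-1)); rewrite [LHS]AE; congr (_ + _).
  by apply: eq_bigr => k _; rewrite ReMr.
rewrite (Im_sum N (fun k => of_real (coef gam N k) * z ^+ (2 ^ k).-1)); rewrite [LHS]BE; congr (_ + _).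
by apply: eq_bigr => k _; rewrite ImMr.
Qed.

End HilbertExpansionTail.

(** * Rudin-Shapiro polynomials *)

Section TrigonometricIntegrals.
Variable R : realType.
Notation mu := (@lebesgue_measure R).
Local Notation D := (`[0%R, (2 * pi)%R]%classic : set R).

Lemma continuous_integrable_2pi (f : R -> R) : continuous f ->
  mu.-integrable D (EFin \o f).
Proof.
move=> cf; apply: continuous_compact_integrable; first exact: segment_compact.
exact: continuous_subspaceT.
Qed.

Lemma continuous_cosM (c : R) : continuous (fun t => cos (c * t)).
Proof.
move=> t; apply: continuous_comp; last exact: continuous_cos.
by apply: cvgM; [exact: cvg_cst|exact: cvg_id].
Qed.

Lemma sin_2piMn n : sin (n%:R * (2 * pi)) = 0 :> R.
Proof.
elim: n => [|n IH]; first by rewrite mul0r sin0.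
by rewrite -natr1 mulrDl mul1r [X in _ + X]mulr_natl sinD2pi.
Qed.

Lemma integral_cos_nat (n : nat) :
  \int[mu]_(t in D) cos (n%:R * t) = if n == 0%N then 2 * pi else 0.
Proof.
have pi20 : 0 < 2 * pi :> R by rewrite mulr_gt0 ?pi_gt0.
case: n => [|n] /=.
  have -> : (fun t : R => cos (0%:R * t)) = cst 1 by apply/funext => t; rewrite mul0r cos0.
  by rewrite Rintegral_cst//= lebesgue_measure_itv /= lte_fin pi20 /= subr0 mul1r.
pose c : R := n.+1%:R; have c0 : c != 0 by rewrite pnatr_eq0.
pose P (t : R) := c^-1 * sin (c * t).
have cP : continuous P.
  move=> t; apply: cvgM; first exact: cvg_cst.
  apply: continuous_comp; last exact: continuous_sin.
  by apply: cvgM; [exact: cvg_cst|exact: cvg_id].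
have dP (x : R) : is_derive x 1 P (cos (c * x)).
  have -> : P = c^-1 \*: (@sin R \o (c \*: id)) by apply/funext => t.
  apply: is_derive_eq; rewrite /= /GRing.scale /=.
  by rewrite mulr1 mulrCA mulVf// mulr1.
rewrite /Rintegral (@continuous_FTC2 _ _ P)//.
- by rewrite /P /= mulr0 sin0 sin_2piMn !mulr0 subr0.
- by apply: continuous_subspaceT; exact: continuous_cosM.
- split.
  + by move=> x _; apply: ex_derive; exact: dP.
  + by apply: cvg_at_right_filter; exact: cP.
  + by apply: cvg_at_left_filter; exact: cP.
- by move=> x _; rewrite derive1E; apply: derive_val.
Qed.

Lemma integral_cos_sub (m n : nat) :
  \int[mu]_(t in D) cos (m%:R * t - n%:R * t) = if m == n then 2 * pi else 0.
Proof.
have [nm|mn] := leqP n m.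
  have -> : (fun t : R => cos (m%:R * t - n%:R * t)) = (fun t => cos ((m - n)%:R * t)).
    by apply/funext => t; rewrite -mulrBl natrB.
  by rewrite integral_cos_nat subn_eq0 eqn_leq nm andbT.
have -> : (fun t : R => cos (m%:R * t - n%:R * t)) = (fun t => cos ((n - m)%:R * t)).
  by apply/funext => t; rewrite -cosN opprB -mulrBl natrB// ltnW.
by rewrite integral_cos_nat subn_eq0 leqNgt mn /= ltn_eqF.
Qed.

Lemma continuous_cos_sub (m n : nat) : continuous (fun t : R => cos (m%:R * t - n%:R * t)).
Proof.
have -> : (fun t : R => cos (m%:R * t - n%:R * t)) = (fun t => cos ((m%:R - n%:R) * t)).
  by apply/funext => t; rewrite mulrBl.
exact: continuous_cosM.
Qed.

End TrigonometricIntegrals.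

Section RudinShapiro.
Variables (R : realType) (eps : R).

(* Rudin-Shapiro polynomials with frequencies [2 ^ n]; [rs n] holds the
   coefficients of the pair [(P_n, Q_n)], where, on the unit circle,
   [P_(n+1) = P_n + eps z^(2^n) conj Q_n] and
   [Q_(n+1) = Q_n - eps z^(2^n) conj P_n]. *)
Fixpoint rs (n : nat) : (nat -> R) * (nat -> R) :=
  if n is n'.+1 then
    let: (a, b) := rs n' in
    (fun i => a i + eps * (if (i <= 2 ^ n')%N then b (2 ^ n' - i)%N else 0),
     fun i => b i - eps * (if (i <= 2 ^ n')%N then a (2 ^ n' - i)%N else 0))
  else (fun=> 0, fun i => (i == 0%N)%:R).

Definition rsP n := (rs n).1.
Definition rsQ n := (rs n).2.

Lemma rsPS n i : rsP n.+1 i =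
  rsP n i + eps * (if (i <= 2 ^ n)%N then rsQ n (2 ^ n - i)%N else 0).
Proof. by rewrite /rsP /rsQ /=; case: (rs n). Qed.

Lemma rsQS n i : rsQ n.+1 i =
  rsQ n i - eps * (if (i <= 2 ^ n)%N then rsP n (2 ^ n - i)%N else 0).
Proof. by rewrite /rsP /rsQ /=; case: (rs n). Qed.

Lemma rsP_large n i : (2 ^ n <= i)%N -> rsP n i = 0.
Proof.
elim: n => [//|n IH] ni; have ni' : (2 ^ n < i)%N.
  by apply: leq_trans ni; rewrite expnS mul2n -addnn -addn1 leq_add2l expn_gt0.
by rewrite rsPS IH ?(ltnW ni')// leqNgt ni' /= mulr0 addr0.
Qed.

(** Apart from its constant term, [Q_n] lives strictly below [2^(n-1)], so reflection in [2^n] keeps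
    it above [2^(n-1)]. The constant term of [P_n] is carried along because reflection would send it
    to frequency [2^n] of [Q_(n+1)]. *)
Lemma rs_large n : rsP n 0%N = 0 /\
  forall i, (0 < i)%N -> (2 ^ n <= 2 * i)%N -> rsQ n i = 0.
Proof.
elim: n => [|n [IHP IHQ]].
  by split=> // i i0 _; rewrite /rsQ /= gtn_eqF.
split.
  rewrite rsPS IHP leq0n subn0 IHQ ?expn_gt0 ?mulr0 ?addr0//.
  by rewrite leq_pmull.
move=> i i0; rewrite expnS leq_mul2l /= => ni.
rewrite rsQS IHQ//; last by apply: leq_trans ni _; rewrite leq_pmull.
case: ifPn => [iN|_]; last by rewrite mulr0 subr0.
have -> : i = (2 ^ n)%N by apply/eqP; rewrite eqn_leq iN.
by rewrite subnn IHP mulr0 subr0.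
Qed.

Lemma rsQ0 n : rsQ n 0%N = 1.
Proof.
elim: n => [//|n IH].
by rewrite rsQS IH leq0n subn0 rsP_large// mulr0 subr0.
Qed.

Lemma rsQ_large n i : (2 ^ n <= i)%N -> rsQ n i = 0.
Proof.
move=> ni; apply: (rs_large n).2; first by apply: leq_trans ni; rewrite expn_gt0.
by apply: leq_trans ni _; rewrite leq_pmull.
Qed.

(** Step [n] creates the coefficient at [2^n] from the constant term [1] of [Q_n]; it leaves the
    earlier powers alone, since [2^n - 2^j >= 2^(n-1)] for [j < n] and [Q_n] vanishes there. *)
Lemma rsP_pow2 n j : rsP n (2 ^ j)%N = if (j < n)%N then eps else 0.
Proof.
elim: n => [//|n IH]; rewrite rsPS IH leq_exp2l//.
have [jn|nj|->] := ltngtP j n.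
- rewrite leqW// (rs_large n).2 ?mulr0 ?addr0//.
    by rewrite subn_gt0 ltn_exp2l.
  have : (2 * 2 ^ j <= 2 ^ n)%N by rewrite -expnS leq_exp2l.
  by move: (2 ^ j)%N (2 ^ n)%N => x y; lia.
- by rewrite ltnS leqNgt nj /= mulr0 addr0.
- by rewrite leqnn subnn rsQ0 mulr1 add0r.
Qed.

(* [trig a M (expi t)] and [trig a M (expi (- t))] are complex conjugate. *)
Definition trig (a : nat -> R) M (w : Cplx R) : Cplx R :=
  \sum_(i < M) of_real (a i) * w ^+ i.

(** On the circle [v] is the conjugate of [w]; the relation [w * v = 1] makes the Rudin-Shapiro
    recursion purely algebraic. *)
Lemma trig_reverse (b : nat -> R) L M (w v : Cplx R) : w * v = 1 -> (L < M)%N ->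
  (forall i, (L < i)%N -> b i = 0) ->
  trig (fun i => if (i <= L)%N then b (L - i)%N else 0) M w = w ^+ L * trig b M v.
Proof.
move=> wv LM bL.
have wpow k : (k <= L)%N -> w ^+ (L - k) = w ^+ L * v ^+ k.
  by move=> kL; rewrite -{2}(subnK kL) exprD -mulrA -exprMn wv expr1n mulr1.
rewrite /trig -(subnKC LM) !big_split_ord /=.
rewrite [X in _ + X]big1 ?addr0; last first.
  by move=> i _; rewrite leqNgt ltnS leq_addr /= -[of_real 0]/(0 : Cplx R) mul0r.
rewrite [X in _ * (_ + X)]big1 ?addr0; last first.
  by move=> i _; rewrite bL ?ltnS ?leq_addr// -[of_real 0]/(0 : Cplx R) mul0r.
rewrite mulr_sumr (reindex_inj rev_ord_inj) /=; apply: eq_bigr => i _.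
have iL : (i <= L)%N by rewrite -ltnS.
rewrite subSS leq_subr subKn// mulrCA; congr (_ * _).
exact: wpow.
Qed.

Lemma trigD a b M w : trig (fun i => a i + eps * b i) M w =
  trig a M w + of_real eps * trig b M w.
Proof.
rewrite /trig mulr_sumr -big_split; apply: eq_bigr => i _ /=.
by rewrite /of_real rmorphD rmorphM mulrDl mulrA.
Qed.

Lemma trigB a b M w : trig (fun i => a i - eps * b i) M w =
  trig a M w - of_real eps * trig b M w.
Proof.
rewrite /trig mulr_sumr -sumrB; apply: eq_bigr => i _ /=.
by rewrite /of_real rmorphB rmorphM mulrBl mulrA.
Qed.

(** The parallelogram law: the opposite signs in the two recursions cancel the cross terms, and each
    step multiplies [|P|^2 + |Q|^2] by [1 + eps^2]. *)
Lemma rs_energy n M (w v : Cplx R) : w * v = 1 -> (2 ^ n <= M)%N ->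
  trig (rsP n) M w * trig (rsP n) M v + trig (rsQ n) M w * trig (rsQ n) M v =
  of_real ((1 + eps ^+ 2) ^+ n).
Proof.
move=> wv; elim: n => [|n IH] nM.
  have q x : trig (rsQ 0) M x = 1.
    rewrite /trig -(prednK nM) big_ord_recl /= expr0 mulr1 big1 ?addr0//.
    by move=> i _; rewrite -[of_real _]/(0 : Cplx R) mul0r.
  have p x : trig (rsP 0) M x = 0.
    by rewrite /trig big1// => i _; rewrite -[of_real _]/(0 : Cplx R) mul0r.
  by rewrite !q !p expr0 mul0r mulr1 add0r.
have nM' : (2 ^ n < M)%N.
  by apply: leq_trans nM; rewrite ltn_exp2l.
have vw : v * w = 1 by rewrite mulrC.
have P0 i : (2 ^ n < i)%N -> rsP n i = 0 by move=> /ltnW; exact: rsP_large.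
have Q0 i : (2 ^ n < i)%N -> rsQ n i = 0 by move=> /ltnW; exact: rsQ_large.
have PE x y : x * y = 1 -> trig (rsP n.+1) M x =
    trig (rsP n) M x + of_real eps * (x ^+ (2 ^ n) * trig (rsQ n) M y).
  move=> xy; rewrite -(trig_reverse xy nM' Q0) -trigD.
  by congr trig; apply/funext => i; exact: rsPS.
have QE x y : x * y = 1 -> trig (rsQ n.+1) M x =
    trig (rsQ n) M x - of_real eps * (x ^+ (2 ^ n) * trig (rsP n) M y).
  move=> xy; rewrite -(trig_reverse xy nM' P0) -trigB.
  by congr trig; apply/funext => i; exact: rsQS.
rewrite !(PE _ _ wv) !(PE _ _ vw) !(QE _ _ wv) !(QE _ _ vw).
rewrite exprSr of_realM -IH ?(ltnW nM')//.
have wvn : w ^+ (2 ^ n) * v ^+ (2 ^ n) = 1 by rewrite -exprMn wv expr1n.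
have -> : of_real (1 + eps ^+ 2) = 1 + of_real eps ^+ 2 :> Cplx R.
  by rewrite -of_realX -of_real1 /of_real rmorphD.
move: wvn; set W := w ^+ _; set V := v ^+ _; set e := of_real eps => WV.
set Pw := trig (rsP n) M w; set Pv := trig (rsP n) M v.
set Qw := trig (rsQ n) M w; set Qv := trig (rsQ n) M v.
transitivity (Pw * Pv + Qw * Qv + e ^+ 2 * (W * V) * (Pw * Pv + Qw * Qv)); first by ring.
by rewrite WV; ring.
Qed.

End RudinShapiro.

(** * Lower bound and conclusion *)

Section Pairing.
Variable R : realType.
Implicit Types (a : nat -> R) (t : R).
Notation mu := (@lebesgue_measure R).
Local Notation D := (`[0%R, (2 * pi)%R]%classic : set R).

Lemma sqr_cabs (z : Cplx R) :
  cabs z ^+ 2 = complex.Re z ^+ 2 + complex.Im z ^+ 2.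
Proof. by rewrite cabsE sqr_sqrtr// addr_ge0 ?sqr_ge0. Qed.

Lemma sqr_cabs_conj (u v : Cplx R) : complex.Re v = complex.Re u ->
  complex.Im v = - complex.Im u -> cabs v ^+ 2 = complex.Re (u * v).
Proof. by move=> Re_v Im_v; rewrite sqr_cabs ReM Re_v Im_v sqrrN mulrN opprK !expr2. Qed.

Lemma expi_mulN t : expi t * expi (- t) = 1.
Proof. by rewrite -expiD subrr expi0. Qed.

Lemma Re_trig a M t :
  complex.Re (trig a M (expi t)) = \sum_(i < M) a i * cos (i%:R * t).
Proof.
rewrite /trig (Re_sum M (fun i => of_real (a i) * expi t ^+ i)).
by apply: eq_bigr => i _; rewrite ReMr -expiMn.
Qed.

Lemma Im_trig a M t :
  complex.Im (trig a M (expi t)) = \sum_(i < M) a i * sin (i%:R * t).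
Proof.
rewrite /trig (Im_sum M (fun i => of_real (a i) * expi t ^+ i)).
by apply: eq_bigr => i _; rewrite ImMr -expiMn.
Qed.

Lemma Re_trigN a M t : complex.Re (trig a M (expi (- t))) = complex.Re (trig a M (expi t)).
Proof.
apply: etrans (Re_trig a M (- t)) _; apply: etrans _ (esym (Re_trig a M t)).
by apply: eq_bigr => i _; rewrite mulrN cosN.
Qed.

Lemma Im_trigN a M t : complex.Im (trig a M (expi (- t))) = - complex.Im (trig a M (expi t)).
Proof.
apply: etrans (Im_trig a M (- t)) _; rewrite (Im_trig a M t) -sumrN.
by apply: eq_bigr => i _; rewrite mulrN sinN mulrN.
Qed.

Lemma sqr_cabs_trig a M t : cabs (trig a M (expi (- t))) ^+ 2 =
  complex.Re (trig a M (expi t) * trig a M (expi (- t))).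
Proof.
exact: sqr_cabs_conj (Re_trigN a M t) (Im_trigN a M t).
Qed.

Lemma cabs_rsP_le (eps : R) n M t : (2 ^ n <= M)%N ->
  cabs (trig (rsP eps n) M (expi (- t))) ^+ 2 <= (1 + eps ^+ 2) ^+ n.
Proof.
move=> nM; have := congr1 (@complex.Re R) (rs_energy eps (expi_mulN t) nM).
rewrite ReD -!sqr_cabs_trig [RHS]/= => <-.
by rewrite lerDl sqr_ge0.
Qed.

Lemma Re_pairing (c a : nat -> R) N M t :
  complex.Re ((\sum_(k < N) of_real (c k) * expi t ^+ (2 ^ k)) * trig a M (expi (- t))) =
  \sum_(k < N) \sum_(i < M) c k * a i * cos ((2 ^ k)%:R * t - i%:R * t).
Proof.
rewrite mulr_suml (Re_sum N (fun k => of_real (c k) * expi t ^+ (2 ^ k) * trig a M (expi (- t)))).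
apply: eq_bigr => k _; rewrite /trig mulr_sumr.
rewrite (Re_sum M (fun i => of_real (c k) * expi t ^+ (2 ^ k) * (of_real (a i) * expi (- t) ^+ i))).
apply: eq_bigr => i _.
by rewrite mulrACA -of_realM ReMr -!expiMn -expiD mulrN.
Qed.

(** Orthogonality of the cosines leaves only the frequencies [i = 2^k]. *)
Lemma integral_pairing (c a : nat -> R) N M : (forall k, (k < N)%N -> (2 ^ k < M)%N) ->
  let L t := complex.Re ((\sum_(k < N) of_real (c k) * expi t ^+ (2 ^ k)) *
                          trig a M (expi (- t))) in
  mu.-integrable D (EFin \o L) /\
  \int[mu]_(t in D) L t = 2 * pi * \sum_(k < N) c k * a (2 ^ k)%N.
Proof.
move=> NM L.
have mD : measurable D by exact: measurable_itv.
pose f k i t := c k * a i * cos ((2 ^ k)%:R * t - i%:R * t).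
have fi k i : mu.-integrable D (EFin \o f k i).
  apply: continuous_integrable_2pi => t; apply: cvgM; first exact: cvg_cst.
  exact: continuous_cos_sub.
have ci (m i : nat) : mu.-integrable D (EFin \o (fun t : R => cos (m%:R * t - i%:R * t))).
  by apply: continuous_integrable_2pi; exact: continuous_cos_sub.
have inner k := Rintegral_sum M (fi k).
have -> : L = (fun t => \sum_(k < N) \sum_(i < M) f k i t).
  by apply/funext => t; rewrite /L Re_pairing.
have [iL ->] := Rintegral_sum N (fun k => (inner k).1).
split => //; rewrite mulr_sumr; apply: eq_bigr => k _; rewrite (inner k).2.
rewrite (bigD1 (Ordinal (NM k (ltn_ord k)))) //= big1 ?addr0.
  by rewrite /f RintegralZl// integral_cos_sub eqxx mulrC.
move=> i ik; rewrite /f RintegralZl// integral_cos_sub ifN ?mulr0//.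
by apply: contra ik => /eqP ki; apply/eqP/val_inj.
Qed.

End Pairing.

Section LowerBound.
Variables (R : realType) (gam : R).
Hypothesis gam_gt1 : 1 < gam.
Notation mu := (@lebesgue_measure R).
Local Notation D := (`[0%R, (2 * pi)%R]%classic : set R).

Let gam_gt0 : 0 < gam. Proof. exact: lt_trans ltr01 gam_gt1. Qed.

Lemma tail_const_ge0 : 0 <= tail_const gam.
Proof.
have /andP[_ g1] := gamV_01 gam_gt1.
by rewrite invr_ge0 mulr_ge0// subr_ge0 ltW.
Qed.

(** The pairing is at least [n (1/16) n^(-1/2)] with [n = N + 1]. In [l], [expR 1] bounds the
    Rudin-Shapiro factor, the subtracted term is the error of [hilbert_expansion], and the last
    division by [2] is the loss in [circle_mean_ge]. *)
Lemma hilbert_hardy_norm_ge q N : 1 <= q ->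
  let l := (Num.sqrt N.+1%:R / (16 * expR 1) - 2 * tail_const gam) / 2 in
  0 < l -> (l%:E <= hardy_norm q (hilbert_op (lac gam) (test_fun gam N.+1)))%E.
Proof.
move=> q1 l l0; set n := N.+1; set e1 : R := expR 1.
have e10 : 0 < e1 by exact: expR_gt0.
have e11 : 1 <= e1 by rewrite -expR0 ler_expR.
(* By Bernoulli [r^(2^k - 1) >= 1/2] for all [k < n], so working at radius [r] only lowers [1/8] to
   [1/16]. *)
pose h : R := 2^-1 ^+ n.+1.
have h0 : 0 < h by rewrite exprn_gt0// invr_gt0.
have h1 : h <= 2^-1.
  by rewrite /h exprS ler_piMr ?invr_ge0// exprn_ile1 ?invr_ge0// invf_le1// ler1n.
pose r := 1 - h.
have r0 : 0 < r by rewrite /r; lra.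
have r1 : r < 1 by rewrite /r; lra.
apply: le_trans (_ : (_ <= integral_mean q r (hilbert_op (lac gam) (test_fun gam n)))%E) _; last first.
  by apply: ereal_sup_ubound; exists r => //=; rewrite in_itv /= r0.
pose eps : R := (Num.sqrt n%:R)^-1.
have n0 : 0 < n%:R :> R by rewrite ltr0n.
have sn0 : 0 < Num.sqrt n%:R :> R by rewrite sqrtr_gt0.
have eps0 : 0 < eps by rewrite invr_gt0.
have epsn : eps * n%:R = Num.sqrt n%:R.
  by rewrite /eps -[X in _ * X](sqr_sqrtr (ltW n0)) expr2 mulrA mulVf ?mul1r// gt_eqF.
pose M := (2 ^ n)%N.
pose A t := trig (rsP eps n) M (expi (- t)).
(* [|A|^2 <= (1 + 1/n)^n <= e <= e^2]; [n^(-1/2)] is the largest order of [eps] that keeps this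
   bounded. *)
have Ale t : cabs (A t) <= e1.
  rewrite -(@ler_pXn2r _ 2)// ?nnegrE ?cabs_ge0 ?(ltW e10)//.
  apply: le_trans (cabs_rsP_le _ _ (leqnn _)) _.
  have -> : eps ^+ 2 = n%:R^-1 by rewrite /eps exprVn sqr_sqrtr// ltW.
  apply: le_trans (_ : expR n%:R^-1 ^+ n <= _).
    by rewrite lerXn2r ?nnegrE ?expR_ge0 ?expR_ge1Dx// addr_ge0 ?invr_ge0 ?(ltW n0).
  by rewrite -expRM_natl divff ?gt_eqF// expr2 ler_peMl// ltW.
pose c k := coef gam n k * r ^+ (2 ^ k).-1.
have c16 k : (k < n)%N -> 16^-1 <= c k.
  move=> kn; apply: le_trans (_ : 8^-1 * 2^-1 <= _); first by lra.
  apply: ler_pM => //; first exact: coef_ge.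
  have := @one_sub_exprn_le R r (2 ^ k).-1 _; rewrite (ltW r0) (ltW r1) => /(_ isT) rk.
  have : (2 ^ k).-1%:R * (1 - r) <= 2^-1.
    have -> : 1 - r = h by rewrite /r opprB addrC subrK.
    apply: le_trans (_ : 2 ^+ n * h <= _); last first.
      by rewrite /h exprSr mulrA -exprMn divff// expr1n mul1r.
    rewrite ler_wpM2r ?(ltW h0)// -natrX ler_nat (leq_trans (leq_pred _))//.
    by rewrite leq_exp2l// ltnW.
  by lra.
pose L0 t := complex.Re ((\sum_(k < n) of_real (c k) * expi t ^+ (2 ^ k)) * A t).
have [iL0 IL0] : mu.-integrable D (EFin \o L0) /\
    \int[mu]_(t in D) L0 t = 2 * pi * \sum_(k < n) c k * rsP eps n (2 ^ k)%N.
  by apply: integral_pairing => k kn; rewrite ltn_exp2l.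
pose T2 := 2 * tail_const gam.
(* A minorant of the modulus of the image: the pairing divided by the bound on [A], less the bound
   on the error. *)
pose L t := e1^-1 * L0 t - T2.
have icst : mu.-integrable D (EFin \o (fun=> T2)).
  by apply: continuous_integrable_2pi; exact: cst_continuous.
have iZ : mu.-integrable D (EFin \o (fun t => e1^-1 * L0 t)).
  by have := integrableZl _ e1^-1 iL0; apply; exact: measurable_itv.
apply: (@circle_mean_ge _ _ _ L) => //.
- move=> t; set z := of_real r * expi t.
  have zr : cabs z < 1 by rewrite cabsM cabs_real cabs_expi mulr1 gtr0_norm.
  have [T Tle HE] := hilbert_expansion gam_gt1 n zr.
  set F := hilbert_op _ _ _ in HE *.
  (* The unimodular factor [expi t] moves the frequencies [2^k - 1] to [2^k], where the
     Rudin-Shapiro coefficients are known. *)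
  have FE : expi t * F = \sum_(k < n) of_real (c k) * expi t ^+ (2 ^ k) + expi t * T.
    rewrite HE mulrDr mulr_sumr; congr (_ + _); apply: eq_bigr => k _.
    have k2 : (2 ^ k = (2 ^ k).-1.+1)%N by rewrite prednK ?expn_gt0.
    rewrite {2}k2 [expi t ^+ _.+1]exprS /c of_realM of_realX /z.
    rewrite [(of_real r * _) ^+ _]exprMn.
    by rewrite mulrCA -[RHS]mulrA; congr (_ * _); rewrite mulrCA.
  have L0E : L0 t = complex.Re (expi t * F * A t) - complex.Re (expi t * T * A t).
    by rewrite FE [in RHS]mulrDl ReD addrK.
  rewrite /L lerBlDr ler_pdivrMl//.
  have A1 : complex.Re (expi t * F * A t) <= e1 * cabs F.
    apply: le_trans (ler_norm _) _; apply: le_trans (Re_le_cabs _) _.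
    by rewrite !cabsM cabs_expi mul1r mulrC ler_wpM2r ?cabs_ge0.
  have A2 : - complex.Re (expi t * T * A t) <= e1 * T2.
    apply: le_trans (ler_norm _) _; rewrite normrN; apply: le_trans (Re_le_cabs _) _.
    by rewrite !cabsM cabs_expi mul1r mulrC ler_pM ?cabs_ge0.
  by rewrite L0E mulrDr lerD.
- by have := integrableB _ iZ icst; apply.
- rewrite RintegralB// RintegralZl// Rintegral_cst//= IL0 measure_0_2pi /=.
  have sum_ge : n%:R * 16^-1 * eps <= \sum_(k < n) c k * rsP eps n (2 ^ k)%N.
    have -> : n%:R * 16^-1 * eps = \sum_(k < n) 16^-1 * eps.
      by rewrite sumr_const card_ord -mulrA mulr_natl.
    by apply: ler_sum => k _; rewrite rsP_pow2 ltn_ord ler_wpM2r ?c16// ltW.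
  have -> : 2 * pi * (2 * l) = e1^-1 * (2 * pi * (n%:R * 16^-1 * eps)) - T2 * (2 * pi).
    have -> : n%:R * 16^-1 * eps = Num.sqrt n%:R * 16^-1 by rewrite -epsn; ring.
    by rewrite /l -/n -/e1 /T2; field; rewrite gt_eqF.
  rewrite lerD2r ler_wpM2l ?invr_ge0 ?(ltW e10)// ler_wpM2l//.
  by rewrite mulr_ge0 ?pi_ge0.
Qed.

End LowerBound.

Section Unbounded.
Variables (R : realType) (p : R).
Hypothesis p_gt2 : 2 < p.
Notation gam := (root2 p).

Lemma hilbert_unbounded q : 1 <= q -> ~ hilbert_bounded (lac gam) p q.
Proof.
move=> q1 [C HC].
have p1 : 1 < p by apply: lt_trans p_gt2; rewrite ltr1n.
have g1 := root2_gt1 p1.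
pose e1 : R := expR 1; have e10 : 0 < e1 by exact: expR_gt0.
pose K := test_norm_const p.
have K0 : 0 <= K by exact: powR_ge0.
have T0 := tail_const_ge0 g1.
(* Obtained by solving [l <= |C| K gam (N + 1)^(1/p)] for the square root in [l]; the sign of [C] is
   unknown, hence [|C|]. *)
pose a := 16 * e1 * 2 * (`|C| * K * gam); pose b := 16 * e1 * (2 * tail_const gam).
have [N] := unbounded_sqrt_vs_root a b p_gt2.
rewrite ltNge => /negP; apply.
set l := (Num.sqrt N.+1%:R / (16 * e1) - 2 * tail_const gam) / 2.
have le : l <= `|C| * (K * (gam * N.+1%:R `^ p^-1)).
  have [l0|l0] := leP l 0.
    by apply: le_trans l0 _; rewrite !mulr_ge0 ?powR_ge0// ltW// (lt_trans _ g1).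
  rewrite -lee_fin; apply: le_trans (@hilbert_hardy_norm_ge _ _ g1 q N q1 l0) _.
  apply: le_trans (HC _ (test_hardy p1 N.+1)) _.
  have hn0 : (0 <= hardy_norm p (test_fun gam N.+1))%E.
    apply: ereal_sup_ge; exists (integral_mean p 2^-1 (test_fun gam N.+1)).
      by exists 2^-1 => //=; rewrite in_itv /= invr_gt0 ltr0n invf_lt1 ?ltr1n.
    exact: poweR_ge0.
  apply: le_trans (_ : (`|C|%:E * hardy_norm p (test_fun gam N.+1) <= _)%E).
    by rewrite lee_wpmul2r// lee_fin ler_norm.
  rewrite EFinM lee_wpmul2l ?lee_fin//.
  apply: le_trans (hardy_norm_test p1 N.+1) _; rewrite lee_fin ler_wpM2l//.
  (* [gam] is [2^(1/p)], and [N + 2 <= 2 (N + 1)] absorbs the index shift of [hardy_norm_test]. *)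
  rewrite -powRM//; apply: ge0_ler_powR; rewrite ?nnegrE ?invr_ge0 ?mulr_ge0//; first by lra.
  by rewrite -natrM ler_nat mul2n -addnn addSn addnS ltnS ltnS leq_addr.
have : Num.sqrt N.+1%:R = 16 * e1 * (2 * l) + b.
  by rewrite /l /b; field; rewrite gt_eqF.
move=> ->; rewrite lerD2r /a.
apply: le_trans (_ : 16 * e1 * (2 * (`|C| * (K * (gam * N.+1%:R `^ p^-1)))) <= _).
  by rewrite ler_wpM2l ?mulr_ge0 ?(ltW e10)// ler_wpM2l.
by rewrite le_eqVlt; apply/orP; left; apply/eqP; ring.
Qed.

End Unbounded.

Theorem corollary1 (R : realType) (p : R) (hp : 2 < p) :
  exists g : Cplx R -> Cplx R,
    [/\ mean_lipschitz p p^-1 g,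
        ~ hilbert_bounded g p 1
      & ~ hilbert_bounded g p p].
Proof.
have p1 : 1 < p by apply: lt_trans hp; rewrite ltr1n.
exists (lac (root2 p)); split; first exact: lac_mean_lipschitz.
- exact: hilbert_unbounded.
- by apply: hilbert_unbounded => //; exact: ltW.
Qed.
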